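(* A directed tree is unary FA-presentable if and only if it is isomorphic to a directed tree obtained by starting from a finite directed tree and attaching to (vertices of) it finitely many shallow stars (each at its centre) and finitely many periodic paths (each at its base).
   Context: A directed graph is a set with a binary edge relation; a directed tree is a directed graph obtained from a tree by assigning a direction to each edge. A structure is unary FA-presentable if there exist a regular language $L\subseteq a^*$ and a surjection $\phi:L\to X$ such that for equality and for the edge relation the set of pairs $(u,v)\in L^2$ whose images are related is regular (the words $\mathrm{conv}(u,v)$ over $\{a,\$\}^2$, reading $u,v$ in parallel and padding the shorter with $\$$, form a regular language). Attaching a directed graph $(T,\eta)$ at a vertex $t\in T$ to a vertex $g$ of $(G,\gamma)$ means taking the disjoint union of the two graphs and identifying $g$ with $t$. A template is $(T,\eta,t_0,t_1)$ with $(T,\eta)$ a finite directed tree, $t_0,t_1\in T$, and $t_0$ a leaf. The graph $\mathcal{S}(T,\eta,t_0,t_1)$ is obtained from countably many disjoint copies $(T^{(j)},\eta^{(j)},t_0^{(j)},t_1^{(j)})$, $j\in\{0,1,2,\dots\}$, by identifying the vertices related by the equivalence relation generated by $\{(t_1^{(j)},t_0^{(j+1)}):j\ge0\}$. If $t_0=t_1$, this is a shallow star; all copies of $t_0$ are identified to one vertex, the centre. If $t_0\ne t_1$, it is a periodic path; its base is the vertex $t_0^{(0)}$. *)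

(* Defs.v *)
From Stdlib Require Import Relations.Relation_Operators.
From mathcomp Require Import all_boot.
Set Implicit Arguments. Unset Strict Implicit. Unset Printing Implicit Defensive.

Definition und (X : Type) (E : X -> X -> Prop) (x y : X) : Prop := E x y \/ E y x.

Definition und_acyclic (X : Type) (E : X -> X -> Prop) : Prop :=
  forall (n : nat) (c : nat -> X), 3 <= n ->
    (forall i j, i < n -> j < n -> c i = c j -> i = j) ->
    ~ (forall i, i < n -> und E (c i) (c (i.+1 %% n))).

Definition directed_tree (X : Type) (E : X -> X -> Prop) : Prop :=
  [/\ inhabited X,
      (forall x, ~ E x x),
      (forall x y, E x y -> ~ E y x),
      (forall x y, clos_refl_trans X (und E) x y)
    & und_acyclic E].

Definition is_leaf (X : Type) (E : X -> X -> Prop) (t : X) : Prop :=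
  exists u, und E t u /\ forall w, und E t w -> w = u.

Definition regular (A : finType) (P : seq A -> Prop) : Prop :=
  exists (Q : finType) (q0 : Q) (d : Q -> A -> Q) (F : pred Q),
    forall w, P w <-> F (foldl d q0 w).

(* unary words: a^n is represented as [nseq n tt] over the alphabet unit.
   Convolution alphabet {a,$}^2 is bool * bool (true = a, false = $). *)
Definition conv (m n : nat) : seq (bool * bool) :=
  mkseq (fun i => (i < m, i < n)) (maxn m n).

(* L is represented as a predicate on exponents n (the word a^n);
   phi maps a^n (for L n) onto X. *)
Definition unary_FA_presentable (X : Type) (E : X -> X -> Prop) : Prop :=
  exists (L : nat -> Prop) (phi : nat -> X),
    [/\ regular (fun w : seq unit => exists n, L n /\ w = nseq n tt),
        (forall x, exists n, L n /\ phi n = x),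
        regular (fun w => exists m n, [/\ L m, L n, phi m = phi n & w = conv m n])
      & regular (fun w => exists m n, [/\ L m, L n, E (phi m) (phi n) & w = conv m n])].

Record template := Template {
  tV : finType;
  tE : rel tV;
  tt0 : tV;
  tt1 : tV }.

Definition valid_template (A : template) : Prop :=
  directed_tree (fun s t : tV A => tE s t) /\ is_leaf (fun s t : tV A => tE s t) (tt0 A).

(* Pre-quotient vertex set: a finite tree F together with, for each attachment
   i < n, countably many copies (j, t), j : nat, t : tV (A i), of template A i. *)
Definition pre_vertex (F : finType) (n : nat) (A : 'I_n -> template) : Type :=
  (F + {i : 'I_n & (nat * tV (A i))%type})%type.

Definition cp (F : finType) (n : nat) (A : 'I_n -> template) (i : 'I_n) (j : nat)
  (t : tV (A i)) : pre_vertex F A :=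
  inr (existT (fun k => (nat * tV (A k))%type) i (j, t)).
Arguments cp F {n A} i j t.


Definition pre_edge (F : finType) (EF : rel F) (n : nat) (A : 'I_n -> template)
  (u v : pre_vertex F A) : Prop :=
  (exists a b, [/\ u = inl a, v = inl b & EF a b]) \/
  (exists i j (s t : tV (A i)), [/\ u = cp F i j s, v = cp F i j t & tE s t]).

(* generating pairs of the identification:
   t1^(j) ~ t0^(j+1) inside S(A i)  (building S(T,eta,t0,t1)), and
   the vertex att i of F ~ t0^(0) of the i-th copy (attaching S(A i) at the
   class of t0^(0): the centre of a shallow star when t0 = t1, the base of a
   periodic path when t0 <> t1). *)
Definition glue (F : finType) (n : nat) (A : 'I_n -> template) (att : 'I_n -> F)
  (u v : pre_vertex F A) : Prop :=
  (exists i j, u = cp F i j (tt1 (A i)) /\ v = cp F i j.+1 (tt0 (A i))) \/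
  (exists i, u = inl (att i) /\ v = cp F i 0 (tt0 (A i))).

Definition iso_to_quotient (V X : Type) (EV R : V -> V -> Prop)
  (EX : X -> X -> Prop) : Prop :=
  exists f : V -> X,
    [/\ (forall x, exists v, f v = x),
        (forall u v, f u = f v <-> clos_refl_sym_trans V R u v)
      & (forall x y, EX x y <-> exists u v, [/\ f u = x, f v = y & EV u v])].

Definition iso_to_attached (X : Type) (E : X -> X -> Prop) (F : finType) (EF : rel F)
  (n : nat) (A : 'I_n -> template) (att : 'I_n -> F) : Prop :=
  iso_to_quotient (pre_edge EF (A:=A)) (glue att) E.
Arguments iso_to_attached X E F EF n A att : clear implicits.
Arguments iso_to_attached {X} E {F} EF {n} A att.

(* Main.v *)
Require Import Defs.
From mathcomp Require Import all_boot.
From Stdlib Require Import Relations.Relation_Operators Relations.Operators_Properties.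
From Stdlib Require Import Eqdep_dec.
From mathcomp Require Import zify boolp.
Set Implicit Arguments. Unset Strict Implicit. Unset Printing Implicit Defensive.

(** A relation on exponents is recognised by an automaton iff it is ultimately
    periodic along the diagonal and, away from the diagonal, in each coordinate
    ([periodic2]).  A finite tree with stars and periodic paths attached satisfies
    this in the coding that lists the copies one after the other.

    Conversely, keep the least code of every vertex: the codes form an ultimately
    periodic set of numbers, and since a tree has no 4-cycle, the edges join nearby
    codes or involve one of finitely many vertices.  Root the tree.  The parent
    function then commutes with the translation by the period, up to finitely many
    exceptions.  Hence a path towards the root that starts far out either drops
    quickly to one of finitely many vertices, which makes its last far vertex the
    top of a branch of a star, or meets its own translate, so that it runs along a
    periodic path.  Cutting the tree above the tops of the star branches and once
    per period on every periodic path yields a finite core and finitely many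
    families of translated finite blocks. *)

(** * Periodicity and automata *)

Definition periodic1 (q K : nat) (P : nat -> Prop) : Prop :=
  forall n, q <= n -> (P (n + K) <-> P n).

(** The three clauses match the ways an automaton reads [conv m n]: the common prefix, then padding
    in one coordinate only. *)
Definition periodic2 (q K : nat) (R : nat -> nat -> Prop) : Prop :=
  [/\ forall m n, q <= m -> q <= n -> (R (m + K) (n + K) <-> R m n),
      forall m n, m + q <= n -> (R m (n + K) <-> R m n)
    & forall m n, n + q <= m -> (R (m + K) n <-> R m n)].

Lemma periodic1_mul q K P j n :
  periodic1 q K P -> q <= n -> (P (n + j * K) <-> P n).
Proof.
move=> HP Hn; elim: j => [|j IH]; first by rewrite addn0.
have := HP (n + j * K); rewrite mulSn addnA addnAC => H.
by rewrite H //; lia.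
Qed.

Lemma periodic1_weaken q K P q' j :
  periodic1 q K P -> q <= q' -> periodic1 q' (j * K) P.
Proof. by move=> HP Hq n Hn; apply: periodic1_mul HP _; lia. Qed.

Lemma periodic2_weaken q K R q' j :
  periodic2 q K R -> q <= q' -> periodic2 q' (j * K) R.
Proof.
move=> [H1 H2 H3] Hq; split=> m n.
- move=> Hm Hn; elim: j => [|j IH]; first by rewrite !addn0.
  rewrite -IH -[X in _ <-> X]H1; try lia.
  by rewrite !mulSn !addnA ![_ + K]addnC !addnA.
- move=> Hn; elim: j => [|j IH]; first by rewrite !addn0.
  by rewrite -IH -[X in _ <-> X]H2 ?mulSn ?[K + _]addnC ?addnA //; lia.
move=> Hn; elim: j => [|j IH]; first by rewrite !addn0.
by rewrite -IH -[X in _ <-> X]H3 ?mulSn ?[K + _]addnC ?addnA //; lia.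
Qed.

Lemma regular_ext (A : finType) (P P' : seq A -> Prop) :
  (forall w, P w <-> P' w) -> regular P -> regular P'.
Proof.
by move=> H [Q [q0 [d [F HF]]]]; exists Q, q0, d, F => w; rewrite -H.
Qed.

Lemma pigeonhole (T : finType) (g : nat -> T) :
  exists i j, [/\ i < j, j <= #|T| & g i = g j].
Proof.
pose h (i : 'I_(#|T|.+1)) := g i.
case: (pselect (injective h)) => [/leq_card|Hh]; first by rewrite card_ord; lia.
suff [i [j [Eh Hij]]] : exists i j, h i = h j /\ i != j.
  case: (ltngtP i j) => Hlt; last by case/eqP: Hij; apply: val_inj.
  - by exists i, j; split=> //; rewrite -ltnS.
  - by exists j, i; split=> //; rewrite -ltnS.
apply: contrapT => Hn; apply: Hh => i j Eh; apply: contrapT => Hij.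
by apply: Hn; exists i, j; split=> //; apply/eqP.
Qed.

(** The orbit enters a cycle of length at most [#|Q|], and every such length divides the
    factorial. *)
Lemma iter_periodic (Q : finType) (f : Q -> Q) x n :
  #|Q| <= n -> iter (n + #|Q|`!) f x = iter n f x.
Proof.
move=> Hn; have [i [j [Hij Hj Eij]]] := pigeonhole (fun i => iter i f x).
have Hp k : iter (k * (j - i) + i) f x = iter i f x.
  elim: k => // k IH; rewrite mulSn -addnA iterD IH -iterD.
  by rewrite subnK // ltnW.
have /dvdnP[k ->] : j - i %| #|Q|`! by apply: dvdn_fact; lia.
have -> : n + k * (j - i) = (n - i) + (k * (j - i) + i) by lia.
by rewrite iterD Hp -iterD subnK //; lia.
Qed.

Lemma foldl_nseq (A S : Type) (d : S -> A -> S) s n a :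
  foldl d s (nseq n a) = iter n (d^~ a) s.
Proof. by elim: n s => //= n IH s; rewrite IH -iterSr. Qed.

Lemma conv_le m n : m <= n ->
  conv m n = nseq m (true, true) ++ nseq (n - m) (false, true).
Proof.
move=> Hmn; apply: (@eq_from_nth _ (true, true)).
  by rewrite size_mkseq size_cat !size_nseq; lia.
move=> i; rewrite size_mkseq => Hi.
rewrite nth_mkseq // nth_cat size_nseq !nth_nseq.
by do ?[case: ifP => ?]; apply/eqP; rewrite xpair_eqE; lia.
Qed.

Lemma conv_ge m n : n <= m ->
  conv m n = nseq n (true, true) ++ nseq (m - n) (true, false).
Proof.
move=> Hmn; apply: (@eq_from_nth _ (true, true)).
  by rewrite size_mkseq size_cat !size_nseq; lia.
move=> i; rewrite size_mkseq => Hi.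
rewrite nth_mkseq // nth_cat size_nseq !nth_nseq.
by do ?[case: ifP => ?]; apply/eqP; rewrite xpair_eqE; lia.
Qed.

Lemma count_conv m n :
  count (fun p : bool * bool => p.1) (conv m n) = m /\
  count (fun p : bool * bool => p.2) (conv m n) = n.
Proof.
by case: (leqP m n) => H; [rewrite conv_le|rewrite conv_ge 1?ltnW];
  rewrite // !count_cat !count_nseq /=; lia.
Qed.

Lemma conv_inj m n m' n' : conv m n = conv m' n' -> m = m' /\ n = n'.
Proof.
by move=> H; have := count_conv m n; rewrite H; case: (count_conv m' n') => -> -> [].
Qed.

Lemma regular_unary_periodic (L : nat -> Prop) :
  regular (fun w : seq unit => exists n, L n /\ w = nseq n tt) ->
  exists q K, 0 < K /\ periodic1 q K L.
Proof.
case=> Q [q0 [d [F HF]]]; exists #|Q|, #|Q|`!; split; first exact: fact_gt0.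
have HL n : L n <-> F (iter n (d^~ tt) q0).
  rewrite -foldl_nseq -HF; split=> [Ln|[n' [Ln' /(congr1 size)]]]; first by exists n.
  by rewrite !size_nseq => ->.
by move=> n Hn; rewrite !HL iter_periodic.
Qed.

(** Reading [conv m n] iterates one letter along the common prefix and another along the tail, so
    [iter_periodic] applies to each exponent separately. *)
Lemma regular_conv_periodic (R : nat -> nat -> Prop) :
  regular (fun w => exists m n, R m n /\ w = conv m n) ->
  exists q K, 0 < K /\ periodic2 q K R.
Proof.
case=> Q [q0 [d [F HF]]]; exists #|Q|, #|Q|`!; split; first exact: fact_gt0.
have HR m n : R m n <-> F (foldl d q0 (conv m n)).
  rewrite -HF; split=> [Ln|[m' [n' [Ln' /conv_inj[-> ->]]]]] //; by exists m, n.
have Hle m k : R m (m + k) <-> F (iter k (d^~ (false, true)) (iter m (d^~ (true, true)) q0)).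
  by rewrite HR conv_le ?leq_addr // foldl_cat !foldl_nseq addKn.
have Hge n k : R (n + k) n <-> F (iter k (d^~ (true, false)) (iter n (d^~ (true, true)) q0)).
  by rewrite HR conv_ge ?leq_addr // foldl_cat !foldl_nseq addKn.
split=> m n.
- move=> Hm Hn; case: (leqP m n) => H.
    have [k Ek] : exists k, n = m + k by exists (n - m); lia.
    by subst n; rewrite addnAC !Hle iter_periodic.
  have [k Ek] : exists k, m = n + k by exists (m - n); lia.
  by subst m; rewrite addnAC !Hge iter_periodic.
- move=> H; have [k Ek] : exists k, n = m + k by exists (n - m); lia.
  by subst n; rewrite -addnA !Hle iter_periodic //; lia.
move=> H; have [k Ek] : exists k, m = n + k by exists (m - n); lia.
by subst m; rewrite -addnA !Hge iter_periodic //; lia.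
Qed.

(** * An automaton for a periodic relation *)

Section PairAutomaton.
Variables (q K : nat) (R : nat -> nat -> Prop).
Hypotheses (K_gt0 : 0 < K) (R_per : periodic2 q K R).

Let Z_gt0 : 0 < q + K. Proof. lia. Qed.
Let I := 'I_(q + K).

(** A counter modulo [K] with preperiod [q]: after [q + K - 1] it returns to [q]. *)
Let inc (a : I) : I := 
  if insub a.+1 is Some b then b else Ordinal (ltac:(lia) : q < q + K).
Let rd n : I := iter n inc (Ordinal Z_gt0).

Let rdP n : exists j, n = rd n + j * K /\ (j = 0 \/ q <= rd n).
Proof.
elim: n => [|n [j [Hn Hj]]]; first by exists 0; split => //; left.
rewrite /rd iterS -/(rd n) /inc; case: insubP => [b _ ->|].
  by exists j; split; lia.
move=> Hb; exists j.+1; have := ltn_ord (rd n); split=> /=; last by right.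
by rewrite mulSn; lia.
Qed.

Let rd_per P n : periodic1 q K P -> (P (rd n) <-> P n).
Proof.
move=> HP; have [j [E [j0|Hj]]] := rdP n; rewrite [X in _ <-> P X]E.
  by rewrite j0 addn0.
by rewrite (periodic1_mul j HP).
Qed.

(** The reduced lengths of the common prefix and of the tail, and the coordinate owning the tail
    ([Some true] for the second); the outer [None] is the sink. *)
Let St := option (I * I * option bool).
Let q0 : St := Some (rd 0, rd 0, None).

Let step (s : St) (c : bool * bool) : St :=
  if s is Some (a, b, ph) then
    match c, ph with
    | (true, true), None => Some (inc a, b, None)
    | (false, true), (None | Some true) => Some (a, inc b, Some true)
    | (true, false), (None | Some false) => Some (a, inc b, Some false)
    | _, _ => None
    end
  else None.

Let acc (s : St) : bool :=
  if s is Some (a, b, ph) then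
    if ph is Some false then `[< R (a + b) a >] else `[< R a (a + b) >]
  else false.

Let word i k ph := nseq i (true, true) ++
  nseq k (if ph is Some false then (true, false) else (false, true)).

Let runP w a b ph : foldl step q0 w = Some (a, b, ph) ->
  exists i k, [/\ a = rd i, b = rd k, w = word i k ph & ph = None -> k = 0].
Proof.
elim/last_ind: w a b ph => [|w c IH] a b ph /=.
  by case=> <- <- <-; exists 0, 0.
rewrite foldl_rcons; case: (foldl _ _ _) IH => [[[a' b'] ph']|] //.
move=> /(_ _ _ _ erefl)[i [k [-> -> -> Hph]]] /=.
have nsr (k' : nat) (x : bool * bool) : rcons (nseq k' x) x = nseq k'.+1 x.
  by elim: k' => //= k' ->.
case: c => [[] []] //.
- case: ph' Hph => // /(_ erefl) -> [<- <- <-].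
  by exists i.+1, 0; split=> //; rewrite /word /= !cats0 nsr.
- case: ph' Hph => [[]|] // Hph [<- <- <-]; exists i, k.+1; split=> //.
    by rewrite /word rcons_cat nsr.
  by rewrite /word Hph //= cats0 -cats1.
- case: ph' Hph => [[]|] // Hph [<- <- <-]; exists i, k.+1; split=> //.
    by rewrite /word rcons_cat nsr.
  by rewrite /word Hph //= cats0 -cats1.
Qed.

Let run_word i k ph : ph != None ->
  foldl step q0 (word i k.+1 ph) = Some (rd i, rd k.+1, ph).
Proof.
move=> Hph; rewrite /word foldl_cat !foldl_nseq.
have -> : iter i (step^~ (true, true)) q0 = Some (rd i, rd 0, None).
  by elim: i => // i IH; rewrite iterS IH.
by case: ph Hph => [[]|] // _; elim: k => //= k ->.
Qed.

Let run_diag i : foldl step q0 (nseq i (true, true)) = Some (rd i, rd 0, None).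
Proof. by rewrite foldl_nseq; elim: i => // i IH; rewrite iterS IH. Qed.

Let R_le i k : R (rd i) (rd i + rd k) <-> R i (i + k).
Proof.
have [H1 H2 H3] := R_per.
rewrite (rd_per (P := fun k => R (rd i) (rd i + k))); last first.
  by move=> n Hn; rewrite addnA H2 //; lia.
rewrite (rd_per (P := fun i => R i (i + k))) // => n Hn.
by rewrite addnAC H1 //; lia.
Qed.

Let R_ge i k : R (rd i + rd k) (rd i) <-> R (i + k) i.
Proof.
have [H1 H2 H3] := R_per.
rewrite (rd_per (P := fun k => R (rd i + k) (rd i))); last first.
  by move=> n Hn; rewrite addnA H3 //; lia.
rewrite (rd_per (P := fun i => R (i + k) i)) // => n Hn.
by rewrite addnAC H1 //; lia.
Qed.

Lemma periodic_regular_conv :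
  regular (fun w => exists m n, R m n /\ w = conv m n).
Proof.
exists St, q0, step, acc => w; split.
  move=> [m [n [Rmn ->]]]; case: (ltngtP m n) => H.
  - rewrite conv_le 1?ltnW //; case E : (n - m) => [|k]; first by lia.
    have := @run_word m k (Some true); rewrite /word => -> //=.
    by apply/asboolP; apply/(R_le m k.+1); rewrite -E subnKC // ltnW.
  - rewrite conv_ge 1?ltnW //; case E : (m - n) => [|k]; first by lia.
    have := @run_word n k (Some false); rewrite /word => -> //=.
    by apply/asboolP; apply/(R_ge n k.+1); rewrite -E subnKC // ltnW.
  - rewrite H in Rmn *; rewrite conv_le // subnn cats0 run_diag /=.
    by apply/asboolP; apply/(R_le n 0); rewrite addn0.
case E : (foldl _ _ _) => [[[a b] ph]|] //.
have [i [k [-> -> -> Hk]]] := runP E.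
rewrite /acc /word; case: ph E Hk => [[]|] E Hk /asboolP.
- by rewrite R_le => Rik; exists i, (i + k); rewrite conv_le ?leq_addr // addKn.
- by rewrite R_ge => Rik; exists (i + k), i; rewrite conv_ge ?leq_addr // addKn.
by rewrite R_le => Rik; exists i, (i + k); rewrite conv_le ?leq_addr // addKn.
Qed.

End PairAutomaton.

(** * Attached stars and paths are presentable *)

Section AttachedPresentable.
Variables (F : finType) (EF : rel F) (n : nat) (A : 'I_n -> template) (att : 'I_n -> F).
Hypothesis tE_irr : forall i (t : tV (A i)), ~~ tE t t.

Local Notation pv := (pre_vertex F A).
Local Notation t0 i := (tt0 (A i)).
Local Notation t1 i := (tt1 (A i)).

Definition shift_copy (u : pv) : pv :=
  match u with
  | inl a => inl a
  | inr (existT i (j, t)) => cp F i j.+1 t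
  end.

Definition copy_index (u : pv) : nat := if u is inr (existT i (j, _)) then j else 0.

Definition copy_ge k (u : pv) : Prop := if u is inr (existT i (j, _)) then k <= j else True.

(** A canonical representative of each gluing class. One rewriting suffices: on a path [tt1] differs
    from [tt0], so [tt1] of the previous copy is already normal. *)
Definition glue_nf (u : pv) : pv :=
  match u with
  | inl a => inl a
  | inr (existT i (j, t)) =>
    if t != t0 i then cp F i j t
    else if t0 i == t1 i then inl (att i)
    else if j is j'.+1 then cp F i j' (t1 i) else inl (att i)
  end.

Lemma cp_inj i j (t : tV (A i)) j' t' : cp F i j t = cp F i j' t' -> j = j' /\ t = t'.
Proof.
move=> E.
by have [-> ->] := inj_pair2_eq_dec _ (@eq_comparable _) _ _ _ _ (inr_inj E).
Qed.

Lemma glue_nfP u v : clos_refl_sym_trans pv (glue att) u v <-> glue_nf u = glue_nf v.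
Proof.
split.
  elim=> //= [{}u {}v|? ? ? _ -> _ ->] //.
  case=> [[i [j [-> ->]]]|[i [-> ->]]] /=.
    rewrite eqxx /= eq_sym; case: eqVneq => //= E; by rewrite E.
  by rewrite eqxx /=; case: ifP.
have H w : clos_refl_sym_trans pv (glue att) w (glue_nf w).
  case: w => [a|[i [j t]]] /=; first exact: rst_refl.
  case: eqVneq => [->|_] /=; last exact: rst_refl.
  have H0 : clos_refl_sym_trans pv (glue att) (cp F i 0 (t0 i)) (inl (att i)).
    by apply/rst_sym/rst_step; right; exists i.
  have HS k : clos_refl_sym_trans pv (glue att) (cp F i k.+1 (t0 i)) (cp F i k (t1 i)).
    by apply/rst_sym/rst_step; left; exists i, k.
  case: eqVneq => [E|_]; last by case: j.
  elim: j => [|j IH] //; apply: rst_trans (HS j) _; by rewrite -E.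
move=> E; apply: rst_trans (H u) _; rewrite E; exact/rst_sym/H.
Qed.

Lemma shift_copy_inj : injective shift_copy.
Proof.
move=> [a|[i [j t]]] [b|[i' [j' t']]] //= E.
have Ei : i = i' := congr1 (@projT1 _ _) (inr_inj E).
by subst i'; move/cp_inj: E => [[->] ->].
Qed.

(** Copy 0 is excluded because [tt0] of a path is glued to the core there, while its shift is glued
    to copy 0. *)
Lemma nf_shift u : copy_ge 1 u -> glue_nf (shift_copy u) = shift_copy (glue_nf u).
Proof.
case: u => [a|[i [j t]]] //=; case: eqP => //= _; case: eqP => //= _; by case: j.
Qed.

Lemma nf_index_ge k u : copy_ge k.+1 u -> copy_ge k (glue_nf u).
Proof.
case: u => [a|[i [j t]]] //=; case: eqP => //= _; last by lia.
by case: eqP => //= _; case: j.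
Qed.

Lemma nf_index_le u : copy_index (glue_nf u) <= copy_index u.
Proof.
case: u => [a|[i [j t]]] //=; case: eqP => //= _; by case: eqP => //= _; case: j.
Qed.

Lemma nf_nonleaf i j (t : tV (A i)) : t != t0 i -> glue_nf (cp F i j t) = cp F i j t.
Proof. by move=> /= ->. Qed.

Lemma shift_inl u a : shift_copy u = inl a -> u = inl a.
Proof. by case: u => [|[i [j t]]]. Qed.

Lemma shift_index k u : copy_ge k u ->
  (exists a, shift_copy u = inl a) \/ k < copy_index (shift_copy u).
Proof. by case: u => [a|[i [j t]]] /= H; [left; exists a|right]. Qed.

(** The Boolean lets one argument treat both orientations. *)
Definition edge_b b (u v : pv) : Prop :=
  if b then pre_edge EF u v else pre_edge EF v u.

Lemma edge_b_cases b u v : edge_b b u v ->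
  (exists a c, u = inl a /\ v = inl c) \/
  (exists i j s t, [/\ u = cp F i j s, v = cp F i j t, s != t &
     forall k, edge_b b (cp F i k s) (cp F i k t)]).
Proof.
by case: b => /= -[[a [c [-> -> H]]]|[i [j [s [t [-> -> H]]]]]];
  [left; exists a, c | right; exists i, j, s, t | left; exists c, a | right; exists i, j, t, s];
  split=> //; try (by move=> k; right; exists i, k, s, t);
  apply: contraTneq H => ->; rewrite ?tE_irr.
Qed.

Definition nf_edge b (u v : pv) : Prop :=
  exists u' v', [/\ glue_nf u' = glue_nf u, glue_nf v' = glue_nf v & edge_b b u' v'].

(** Distinct ends of an edge inside one copy are not both [tt0], so one end is its own normal form
    and reveals the copy. The bound 2 pays for the copy lost by normalisation, so the edge moves
    between copies without meeting copy 0. *)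
Lemma nf_edge_shift b u v : copy_ge 2 u -> copy_ge 2 v ->
  (nf_edge b (shift_copy u) (shift_copy v) <-> nf_edge b u v).
Proof.
have ge1 w : copy_ge 2 w -> copy_ge 1 w by case: w => // -[? []] /=; lia.
move=> Hu Hv; have [Hu1 Hv1] := (ge1 _ Hu, ge1 _ Hv).
have [Nu Nv] := (nf_index_ge Hu, nf_index_ge Hv).
split=> -[u' [v' [E1 E2 H]]].
  rewrite !nf_shift // in E1 E2.
  have [[a [c [? ?]]]|[i [j [s [t [? ? st Hk]]]]]] := edge_b_cases H; subst u' v'.
    by exists (inl a), (inl c); rewrite (shift_inl (esym E1)) (shift_inl (esym E2)).
  have j2 : 1 < j.
    move: st; have [->|/nf_nonleaf Hs _] := eqVneq s (t0 i).
      rewrite eq_sym => /nf_nonleaf Ht; rewrite Ht in E2.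
      by have [[? /(etrans E2)]|] := shift_index Nv; rewrite -?E2.
    by rewrite Hs in E1; have [[? /(etrans E1)]|] := shift_index Nu; rewrite -?E1.
  case: j j2 E1 E2 H => // j j1 E1 E2 H.
  exists (cp F i j s), (cp F i j t); split=> //; apply: shift_copy_inj.
    by rewrite -nf_shift.
  by rewrite -nf_shift.
have [[a [c [? ?]]]|[i [j [s [t [? ? st Hk]]]]]] := edge_b_cases H; subst u' v'.
  by exists (inl a), (inl c); rewrite !nf_shift // -E1 -E2.
have j1 : 0 < j.
  move: st; have [->|/nf_nonleaf Hs _] := eqVneq s (t0 i).
    by rewrite eq_sym => /nf_nonleaf Ht; move: Nv; rewrite -E2 Ht.
  by move: Nu; rewrite -E1 Hs.
exists (cp F i j.+1 s), (cp F i j.+1 t); split=> //.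
  by rewrite nf_shift // -E1 -nf_shift.
by rewrite nf_shift // -E2 -nf_shift.
Qed.

(* If the endpoints of an edge lie in copies that are far apart, then the edge
   joins the centre of a star to a vertex of one of its copies. *)
Lemma nf_edge_far b u v k : copy_index u <= k -> copy_ge k.+3 v ->
  (nf_edge b u (shift_copy v) <-> nf_edge b u v).
Proof.
move=> Hu Hv.
have Nu : copy_index (glue_nf u) <= k := leq_trans (nf_index_le u) Hu.
have Nv := nf_index_ge Hv.
have Hv1 : copy_ge 1 v by case: v Hv {Nv} => // -[? []] /=; lia.
(* If [t] were [tt0], then [s] would be normal and place the copy at or before [k]. If [s] were not
   [tt0], or the template were a path, the normal form of [s] would lie past [k]. *)
have star i j (s t : tV (A i)) : s != t -> glue_nf (cp F i j s) = glue_nf u ->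
    k.+1 < copy_index (glue_nf (cp F i j t)) ->
    [/\ t != t0 i, s = t0 i, t0 i = t1 i & k.+1 < j].
  move=> st Es; have [Et|Nt] := eqVneq t (t0 i).
    rewrite Et in st *; have jk : j <= k by move: Nu; rewrite -Es nf_nonleaf.
    by have : _ <= j := nf_index_le (cp F i j (t0 i)); lia.
  rewrite nf_nonleaf //= => kj; have [E|Ns] := eqVneq s (t0 i); last first.
    by move: Nu; rewrite -Es nf_nonleaf //=; lia.
  split=> //; move: Nu; rewrite -Es E /= eqxx /=; case: eqP => //= _.
  by case: j kj {Es} => //= j; lia.
split=> -[u' [v' [E1 E2 H]]].
  rewrite nf_shift // in E2.
  have [[a [c [? ?]]]|[i [j [s [t [? ? st Hk]]]]]] := edge_b_cases H; subst u' v'.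
    by exists (inl a), (inl c); rewrite (shift_inl (esym E2)).
  have [[a Ea]|hi] := shift_index Nv.
    exists (cp F i j s), (cp F i j t); split=> //.
    by rewrite (shift_inl Ea) E2 Ea.
  have [|Nt Es Ei kj] := star _ _ _ _ st E1; first by rewrite E2; lia.
  case: j kj E1 E2 H => // j kj E1 E2 H.
  exists (cp F i j s), (cp F i j t); split=> //.
    by rewrite -E1 Es /= eqxx Ei eqxx.
  by apply: shift_copy_inj; rewrite -E2 !nf_nonleaf.
have [[a [c [? ?]]]|[i [j [s [t [? ? st Hk]]]]]] := edge_b_cases H; subst u' v'.
  by exists (inl a), (inl c); rewrite nf_shift // -E2.
have [[a Ea]|hi] : (exists a, glue_nf v = inl a) \/ k.+1 < copy_index (glue_nf v).
- by move: Nv; case: (glue_nf v) => [a|[i' [j' t']]]; [left; exists a|right].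
- exists (cp F i j s), (cp F i j t); split=> //.
  by rewrite nf_shift // E2 Ea.
have [|Nt Es Ei kj] := star _ _ _ _ st E1; first by rewrite E2; lia.
exists (cp F i j.+1 s), (cp F i j.+1 t); split=> //.
  by rewrite -E1 Es /= eqxx Ei eqxx.
by rewrite nf_shift // -E2 !nf_nonleaf.
Qed.

Lemma nf_eq_far u v k : copy_index u <= k -> copy_ge k.+3 v ->
  (glue_nf u = glue_nf (shift_copy v) <-> glue_nf u = glue_nf v).
Proof.
move=> Hu Hv.
have Nu : copy_index (glue_nf u) <= k := leq_trans (nf_index_le u) Hu.
have Nv := nf_index_ge Hv.
have Hv1 : copy_ge 1 v by case: v Hv {Nv} => // -[? []] /=; lia.
rewrite nf_shift //; case: (glue_nf v) Nv => // -[i' [j' t']] /= kj.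
by split=> E; move: Nu; rewrite E /=; lia.
Qed.

Lemma attached_presentable (X : Type) (E : X -> X -> Prop) :
  inhabited F -> iso_to_attached E EF A att -> unary_FA_presentable E.
Proof.
move=> [a0] [f [f_surj f_eq f_edge]].
(* The code [m] stands for slot [m %% K] of copy [m %/ K]. Vertices of [F] own a slot in every copy,
   so they have infinitely many codes, and adding [K] becomes [shift_copy]. *)
pose Slot := (F + {i : 'I_n & tV (A i)})%type.
pose K := #|{: Slot}|.
have K_gt0 : 0 < K by apply/card_gt0P; exists (inl a0).
pose slot m : Slot := enum_val (Ordinal (ltn_pmod m K_gt0)).
pose decode m : pv := match slot m with
  | inl a => inl a
  | inr (existT i t) => cp F i (m %/ K) t
  end.
have slotE j (s : Slot) : slot (j * K + enum_rank s) = s.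
  rewrite /slot -[RHS]enum_rankK; congr enum_val; apply: val_inj => /=.
  by rewrite modnMDl modn_small.
have decode_surj u : exists m, decode m = u.
  case: u => [a|[i [j t]]].
    by exists (0 * K + enum_rank (inl a : Slot)); rewrite /decode slotE.
  exists (j * K + enum_rank (inr (existT _ i t) : Slot)); rewrite /decode slotE.
  by rewrite divnMDl // divn_small // addn0.
have decode_shift m : decode (m + K) = shift_copy (decode m).
  have slot_shift : slot (m + K) = slot m.
    by congr enum_val; apply: val_inj; rewrite /= modnDr.
  rewrite /decode slot_shift; case: (slot m) => // -[i t] /=.
  by rewrite divnDr ?dvdnn // divnn K_gt0 addn1.
have decode_ge k m : k * K <= m -> copy_ge k (decode m).
  by rewrite /decode; case: (slot m) => // -[i t] /=; rewrite leq_divRL.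
have decode_le m : copy_index (decode m) <= m %/ K.
  by rewrite /decode; case: (slot m) => // -[i t] /=.
have far m k : m + 4 * K <= k -> copy_ge (m %/ K).+3 (decode k).
  move=> H; apply: decode_ge; have := leq_trunc_div m K; lia.
have eqE u v : f u = f v <-> glue_nf u = glue_nf v by rewrite f_eq glue_nfP.
have edgeE u v : E (f u) (f v) <-> nf_edge true u v.
  by rewrite f_edge; split=> -[u' [v' [/eqE E1 /eqE E2 H]]]; exists u', v'.
have edge_flip u v : nf_edge true u v <-> nf_edge false v u.
  by split=> -[u' [v' [E1 E2 H]]]; exists v', u'.
exists (fun=> True), (fun m => f (decode m)); split.
- exists unit, tt, (fun _ _ => tt), predT => w; split=> // _.
  exists (size w); split=> //; by elim: w => //= -[] w {1}->.
- by move=> x; have [u <-] := f_surj x; have [m <-] := decode_surj u; exists m.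
- apply: (@regular_ext _ (fun w => exists m k, f (decode m) = f (decode k) /\ w = conv m k)).
    move=> w; split=> -[m [k]]; first by case=> H1 H2; exists m, k; split.
    by case=> _ _ H1 H2; exists m, k.
  apply: (@periodic_regular_conv (4 * K) K) => //; split=> m k.
  + move=> Hm Hk; rewrite !eqE !decode_shift !nf_shift; [|apply: decode_ge; lia..].
    by split=> [/shift_copy_inj|->].
  + by move=> H; rewrite !eqE decode_shift (nf_eq_far (decode_le m)) //; apply: far.
  + move=> H; have {}H := far _ _ H.
    rewrite !eqE decode_shift; split=> /esym E'; apply: esym.
      by rewrite -(nf_eq_far (decode_le k)).
    by rewrite (nf_eq_far (decode_le k)).
- apply: (@regular_ext _ (fun w => exists m k, E (f (decode m)) (f (decode k)) /\ w = conv m k)).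
    move=> w; split=> -[m [k]]; first by case=> H1 H2; exists m, k; split.
    by case=> _ _ H1 H2; exists m, k.
  apply: (@periodic_regular_conv (4 * K) K) => //; split=> m k.
  + move=> Hm Hk; rewrite !edgeE !decode_shift nf_edge_shift //; apply: decode_ge; lia.
  + by move=> H; rewrite !edgeE decode_shift (nf_edge_far _ (decode_le m)) //; apply: far.
  + move=> H; have {}H := far _ _ H.
    by rewrite !edgeE decode_shift !edge_flip (nf_edge_far _ (decode_le k)).
Qed.

End AttachedPresentable.

(** * Rooted trees *)

Lemma und_sym (X : Type) (E : X -> X -> Prop) x y : und E x y -> und E y x.
Proof. by case; [right|left]. Qed.

Section Rooted.
Variables (X : Type) (E : X -> X -> Prop) (r : X).
Hypothesis E_tree : directed_tree E.

Fixpoint walk k x : Prop :=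
  if k is k'.+1 then exists y, und E x y /\ walk k' y else x = r.

Lemma walk_exists x : exists k, `[< walk k x >].
Proof.
have [_ _ _ conn _] := E_tree.
have := conn x r; rewrite clos_rt_rt1n_iff.
move: {-2}r (erefl r) => z Ez H; elim: H Ez => [{}x ->|{}x y {}z xy _ IH Ez].
  by exists 0; apply/asboolP.
by have [k /asboolP Hk] := IH Ez; exists k.+1; apply/asboolP; exists y.
Qed.

(** The parent is a neighbour one step closer to the root. An edge that is not a parent edge would
    close a cycle with the root paths of its ends. *)
Lemma rooted_tree : exists (par : X -> X) (dep : X -> nat),
  [/\ par r = r /\ dep r = 0,
      forall x, x <> r -> dep x = (dep (par x)).+1,
      forall x, x <> r -> und E x (par x)
    & forall x y, und E x y -> (x <> r /\ par x = y) \/ (y <> r /\ par y = x)].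
Proof.
have [_ irr _ _ acyc] := E_tree.
pose dep x := ex_minn (walk_exists x).
have dep_walk x : walk (dep x) x by rewrite /dep; case: ex_minnP => k /asboolP.
have dep_min x k : walk k x -> dep x <= k.
  by rewrite /dep; case: ex_minnP => j _ H Hk; apply/H/asboolP.
have dep_r : dep r = 0 by apply/eqP; rewrite -leqn0; apply: dep_min.
have dep0 x : dep x = 0 -> x = r by move=> H; have := dep_walk x; rewrite H.
have /choice[par Hpar] : forall x, exists y,
    (x = r -> y = r) /\ (x <> r -> und E x y /\ dep x = (dep y).+1).
  move=> x; have [->|xr] := pselect (x = r); first by exists r.
  have := dep_walk x; case Ek : (dep x) => [|k]; first by move/dep0: Ek.
  move=> [y [xy Hy]]; exists y; split=> // _; split=> //.
  apply/eqP; rewrite eqn_leq ltnS; apply/andP; split; last exact: dep_min.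
  by rewrite -ltnS -Ek; apply: dep_min; exists y.
have par_edge x : x <> r -> und E x (par x) by move=> H; have [_ /(_ H)[]] := Hpar x.
have par_dep x : x <> r -> dep x = (dep (par x)).+1.
  by move=> H; have [_ /(_ H)[]] := Hpar x.
exists par, dep; split=> //; first by have [/(_ erefl)] := Hpar r.
move=> x y xy; apply: contrapT => Hno.
have Nxy : x <> r -> par x <> y by move=> H1 H2; apply: Hno; left.
have Nyx : y <> r -> par y <> x by move=> H1 H2; apply: Hno; right.
have dep_iter i z : i <= dep z -> dep (iter i par z) = dep z - i.
  elim: i => [|i IH] Hi /=; first by rewrite subn0.
  have := IH (ltnW Hi) => Hd; have /par_dep : iter i par z <> r.
    by move=> Er; rewrite Er dep_r in Hd; lia.
  lia.
have iter_inj z i j : i <= dep z -> j <= dep z -> iter i par z = iter j par z -> i = j.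
  by move=> Hi Hj /(congr1 dep); rewrite !dep_iter //; lia.
have iter_edge z i : i < dep z -> und E (iter i par z) (iter i.+1 par z).
  move=> Hi; apply: par_edge => Er; have := dep_iter i z (ltnW Hi).
  by rewrite Er dep_r; lia.
have iter_root z : iter (dep z) par z = r.
  by apply: dep0; rewrite dep_iter // subnn.
(* The least such [i] makes the path from [x] meet the root path of [y] for the first time. *)
have Hmeet : exists i, `[< exists j, j <= dep y /\ iter i par x = iter j par y >].
  exists (dep x); apply/asboolP; exists (dep y); split=> //.
  by rewrite !iter_root.
case: (ex_minnP Hmeet) => i /asboolP[j [Hj Eij]] Hmin.
have Hi : i <= dep x.
  apply: Hmin; apply/asboolP; exists (dep y); split=> //.
  by rewrite !iter_root.
(* The cycle climbs from [x] to the meeting point, descends to [y], and closes with the edge. *)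
pose c k := if k <= i then iter k par x else iter (i + j - k) par y.
have cross k l : k <= i -> l < j -> iter k par x <> iter l par y.
  move=> Hk Hl Ekl; have [E1|ki] := eqVneq k i.
    by rewrite E1 Eij in Ekl; have := iter_inj y _ _ Hj _ Ekl; lia.
  have := Hmin k; rewrite leqNgt ltn_neqAle ki Hk => /(_ _)/negP[] //.
  by apply/asboolP; exists l; split=> //; lia.
apply: (acyc (i + j).+1 c).
(* A cycle shorter than 3 would mean a loop or one of the two excluded parent relations. *)
- have Hx : i = 0 -> j <= 1 -> False.
    move=> i0 Hj1; rewrite i0 /= in Eij; case: j Hj Hj1 Eij {c cross} => [|[|]] //= Hj _ Eij.
      by case: xy; rewrite Eij; apply: irr.
    by apply: Nyx (esym Eij) => Er; rewrite Er dep_r in Hj.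
  have Hy : i = 1 -> j = 0 -> False.
    move=> i1 j0; rewrite i1 j0 /= in Eij Hi.
    by apply: Nxy Eij => Er; rewrite Er dep_r in Hi.
  by case: (i) Hx Hy => [|[|?]]; case: (j) => [|[|?]] //=; lia.
- move=> k l Hk Hl; rewrite /c; case: leqP => Hki; case: leqP => Hli.
  + by apply: iter_inj; lia.
  + by move/cross; case; lia.
  + by move/esym/cross; case; lia.
  + by move/iter_inj => H; have := H ltac:(lia) ltac:(lia); lia.
move=> k Hk; have [Ek|Nk] := eqVneq k (i + j).
  rewrite Ek modnn /c leq0n /=; case: leqP => Hj0.
    have j0 : j = 0 by lia.
    by rewrite j0 addn0 Eij j0; apply: und_sym.
  by rewrite subnn; apply: und_sym.
rewrite modn_small; last lia.
rewrite /c; case: (ltngtP k i) => Hki.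
- by apply: iter_edge; lia.
- have -> : i + j - k = (i + j - k.+1).+1 by lia.
  by apply/und_sym/iter_edge; lia.
rewrite Hki in Nk *; rewrite Eij.
have Ej : j = (i + j - i.+1).+1 by lia.
by rewrite {1}Ej; apply/und_sym/iter_edge; lia.
Qed.

End Rooted.

(** The rank [dd] makes every vertex descend to [y0], which gives connectedness; the rest is
    inherited along [g]. *)
Lemma induced_tree (X Y : Type) (E : X -> X -> Prop) (EY : Y -> Y -> Prop)
    (g : Y -> X) (y0 : Y) (dd : Y -> nat) :
  directed_tree E -> injective g -> (forall a b, EY a b <-> E (g a) (g b)) ->
  (forall a, a = y0 \/ exists b, und EY a b /\ dd b < dd a) -> directed_tree EY.
Proof.
move=> [_ irr asym _ acyc] g_inj EYE conn.
have to0 a : clos_refl_trans Y (und EY) a y0 /\ clos_refl_trans Y (und EY) y0 a.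
  have [m] := ubnP (dd a); elim: m a => // m IH a Ha.
  case: (conn a) => [->|[b [ab Hb]]]; first by split; apply: rt_refl.
  have [|H1 H2] := IH b; first lia.
  split; first by apply: rt_trans H1; apply: rt_step.
  by apply: rt_trans H2 _; apply: rt_step; apply: und_sym.
split.
- exact: inhabits y0.
- by move=> x /EYE/irr.
- by move=> x y /EYE/asym H /EYE.
- by move=> x y; apply: rt_trans (to0 x).1 (to0 y).2.
move=> n c Hn c_inj Hc; apply: (acyc n (g \o c) Hn).
  by move=> i j Hi Hj /g_inj; apply: c_inj.
by move=> i Hi; case: (Hc i Hi) => /EYE; [left|right].
Qed.

(** * Decomposition of a periodic tree *)

(** Low numbers stay fixed because infinitely many far vertices may be joined to one of them, as to
    the centre of a star. *)
Definition shift_above (N c n : nat) : nat := if n < N then n else n + c.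

Section PeriodicTree.
Variables (S : nat -> Prop) (e : nat -> nat -> Prop) (K N : nat).
Variables (par dep : nat -> nat) (r : nat).
Hypotheses (K_gt0 : 0 < K) (S_per : periodic1 N K S) (e_per : periodic2 N K e).
Hypotheses (S_r : S r) (par_r : par r = r) (S_par : forall n, S n -> S (par n)).
Hypothesis par_dep : forall n, S n -> n <> r -> dep n = (dep (par n)).+1.
Hypothesis par_edge : forall n, S n -> n <> r -> und e n (par n).
Hypothesis edge_par : forall m n, und e m n ->
  (m <> r /\ par m = n) \/ (n <> r /\ par n = m).
Hypothesis edge_S : forall m n, und e m n -> S m /\ S n.

Local Notation sh := (shift_above N).

Lemma und_diag m n : N <= m -> N <= n -> (und e (m + K) (n + K) <-> und e m n).
Proof. by move=> Hm Hn; have [H _ _] := e_per; rewrite /und !H. Qed.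

Lemma und_far m n : m + N <= n -> (und e m (n + K) <-> und e m n).
Proof. by move=> Hm; have [_ H1 H2] := e_per; rewrite /und H1 ?H2. Qed.

(** A deepest vertex of the cycle would have both of its neighbours as parent. *)
Lemma no_4cycle a b c d :
  und e a b -> und e a d -> und e c b -> und e c d -> a <> c -> b <> d -> False.
Proof.
move=> ab ad cb cd ac bd.
have [Sa Sb] := edge_S ab; have [Sc Sd] := edge_S cd.
have := @par_dep a Sa; have := @par_dep b Sb; have := @par_dep c Sc; have := @par_dep d Sd.
by case: (edge_par ab) => -[n1 E1]; case: (edge_par ad) => -[n2 E2];
  case: (edge_par cb) => -[n3 E3]; case: (edge_par cd) => -[n4 E4];
  rewrite ?E1 ?E2 ?E3 ?E4; try congruence; lia.
Qed.

(** Otherwise periodicity joins both [m] and [m + K] to both [n + K] and [n + K + K]. *)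
Lemma edge_near m n : und e m n -> N <= m -> n < m + N.
Proof.
move=> mn Hm; rewrite ltnNge; apply/negP => Hn.
have mn1 := (und_far Hn).2 mn.
apply: (@no_4cycle m (n + K) (m + K) (n + K + K)) => //; try lia.
- by rewrite und_far //; lia.
- by rewrite und_diag //; lia.
- by rewrite und_diag //; lia.
Qed.

Lemma S_iter s n : S n -> S (iter s par n).
Proof. by move=> Sn; elim: s => //= s; apply: S_par. Qed.

Lemma par_neq n : S n -> n <> r -> par (par n) <> n.
Proof.
move=> Sn nr E; have H1 := par_dep Sn nr; have H2 := @par_dep _ (S_par Sn).
have [E0|N0] := eqVneq (par n) r; first by rewrite E0 par_r in E; rewrite E in nr.
by have := H2 (elimN eqP N0); rewrite E; lia.
Qed.

Lemma par_root n : S n -> exists s, iter s par n = r.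
Proof.
have [m] := ubnP (dep n); elim: m n => // m IH n Hn Sn.
have [->|/eqP nr] := eqVneq n r; first by exists 0.
have [|s Hs] := IH (par n) _ (S_par Sn); first by have := par_dep Sn nr; lia.
by exists s.+1; rewrite iterSr.
Qed.

Lemma iter_r s : iter s par r = r. Proof. exact: iter_fix. Qed.

(** Every path reaches [r] and stays there; finitely many starting points have a common bound. *)
Lemma ancestors_bounded Q : exists W, forall a, a < Q -> S a -> forall s, iter s par a < W.
Proof.
elim: Q => [|Q [W HW]]; first by exists 0.
have H1 k a : iter k par a = r -> exists W, forall s, iter s par a < W.
  elim: k a => [|k IH] a; first by move=> /= ->; exists r.+1 => s; rewrite iter_r.
  rewrite iterSr => /IH[W1 HW1]; exists (maxn W1 a.+1) => -[|s] /=; first by lia.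
  by rewrite -iterS iterSr; have := HW1 s; lia.
have [SQ|NQ] := pselect (S Q); last first.
  exists W => a; rewrite ltnS leq_eqVlt => /orP[/eqP->|] //; exact: HW.
have [k /H1[W1 HW1]] := par_root SQ.
exists (maxn W W1) => a; rewrite ltnS leq_eqVlt => /orP[/eqP-> _ s|Ha Sa s].
  by have := HW1 s; lia.
by have := HW _ Ha Sa s; lia.
Qed.

Lemma par_near n : S n -> N <= n -> n <> r ->
  par n < N \/ (n < par n + N /\ par n < n + N).
Proof.
move=> Sn Hn nr; have H := par_edge Sn nr.
case: (ltnP (par n) N) => Hp; [by left|right].
by split; apply: edge_near => //; apply: und_sym.
Qed.

(* Where the parent function and its translate disagree, the parent edge points in
   opposite directions, so the disagreements propagate along the path to the root;
   reading the translated path backwards shows that there are finitely many. *)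
Lemma par_shift_bounded : exists N1, [/\ N + N <= N1, r < N1 &
  forall n, S n -> N1 <= n -> par (n + K) = sh K (par n)].
Proof.
have [W0 HW0] := ancestors_bounded N.
pose Q := (N + N) + W0 + r.+1.
have S_up n : S n -> N <= n -> S (n + K) by move=> Sn Hn; apply/(S_per Hn).
have differ n : S n -> Q <= n -> par (n + K) <> sh K (par n) ->
    exists a s, [/\ S a, a < Q, N <= a & n + K = iter s par (a + K)].
  have [m] := ubnP (dep n); elim: m n => // m IH n Hm Sn Qn Hd.
  have nr : n <> r by lia.
  have nKr : n + K <> r by lia.
  have Hn := par_edge Sn nr; have Sp := S_par Sn.
  (* A low parent is also adjacent to [n + K]; were it a child of [n + K], then [n + K] would be an
     ancestor of a number below [N], hence below [W0]. *)
  case: (ltnP (par n) N) => pN.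
    case: Hd; rewrite /shift_above pN.
    have : und e (par n) (n + K) by rewrite und_far; [exact: und_sym|lia].
    case/edge_par => -[] // _ E; have := HW0 _ pN Sp 1; rewrite /= E; lia.
  (* In the remaining orientation [par n + K] has parent [n + K]. Then [par n] disagrees as well,
     since agreement would make [n] the parent of [par n]. *)
  have : und e (n + K) (par n + K) by rewrite und_diag //; lia.
  case/edge_par => -[_ E]; first by case: Hd; rewrite /shift_above ltnNge pN.
  case: (ltnP (par n) Q) => pQ; first by exists (par n), 1.
  have [||||a [s [Sa aQ Na Es]]] := IH (par n) => //.
  - by have := par_dep Sn nr; lia.
  - rewrite E /shift_above; case: ltnP => H H'; first by lia.
    by apply: (@par_neq _ Sn) => //; lia.
  by exists a, s.+1; split=> //=; rewrite -Es.
have [W HW] := ancestors_bounded (Q + K).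
exists (Q + W); split; try lia.
move=> n Sn Hn; apply: contrapT => /(differ _ Sn)[|a [s [Sa aQ Na Es]]]; first lia.
by have := HW (a + K) ltac:(lia) (S_up _ Sa Na) s; lia.
Qed.

Variable N1 : nat.
Hypotheses (NN1 : N + N <= N1) (r_N1 : r < N1).
Hypothesis par_shiftK : forall n, S n -> N1 <= n -> par (n + K) = sh K (par n).

Lemma S_shift j n : N <= n -> (S (n + j * K) <-> S n).
Proof. exact: periodic1_mul. Qed.

Lemma par_shift j n : S n -> N1 <= n -> par (n + j * K) = sh (j * K) (par n).
Proof.
move=> Sn Hn; elim: j => [|j IH]; first by rewrite /shift_above !addn0 if_same.
rewrite mulSn addnCA addnC par_shiftK; [|by apply/S_shift => //; lia|lia].
rewrite IH /shift_above; case: (ltnP (par n)) => H; first by rewrite H.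
by rewrite ltnNge (leq_trans H) ?leq_addr //= -addnA [j * K + K]addnC.
Qed.

Lemma iter_shift j n s : S n -> (forall i, i < s -> N1 <= iter i par n) ->
  N <= iter s par n -> iter s par (n + j * K) = iter s par n + j * K.
Proof.
move=> Sn; elim: s => //= s IH Hi Hs.
rewrite IH; [|by move=> i Hi'; apply: Hi; lia|by have := Hi s (leqnn _); lia].
by rewrite par_shift ?Hi //; [rewrite /shift_above ltnNge Hs|apply: S_iter].
Qed.

Lemma iter_unshift j n s : S n -> (forall i, i <= s -> N1 + j * K <= iter i par n) ->
  S (n - j * K) /\ forall i, i <= s -> iter i par (n - j * K) + j * K = iter i par n.
Proof.
move=> Sn Hi; have n_ge := Hi 0 (leq0n _); simpl in n_ge.
have Sm : S (n - j * K) by apply/(@S_shift j); [lia|rewrite subnK //; lia].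
split=> //; elim=> [|i IH] His /=; first by rewrite subnK //; lia.
have E := IH (ltnW His); have Hi0 := Hi _ (ltnW His); have Hi1 := Hi _ His.
move: Hi1; rewrite /= -E par_shift; [|exact: S_iter|lia].
by rewrite /shift_above; case: ltnP => //; lia.
Qed.

(* Far up, the path to the root returns to the residue class modulo [K] of one of
   its vertices after fewer than [N * K] downward units; [N`!] absorbs all these
   periods at once. *)
Definition long_period := N`! * K.
Local Notation D := long_period.

Definition recurrent y := exists t, iter t par y + D = y.

(** The first [K] steps lose little height unless the path falls below [N], and the vertex before
    such a fall is high. Otherwise two of these vertices are congruent modulo [K]; the later one
    must be lower, and repeating the segment between them descends by exactly [D]. *)
Lemma star_or_recurrent Z0 : exists Z, forall n, S n -> Z <= n ->
  exists i, Z0 <= iter i par n /\ (iter i.+1 par n < N \/ recurrent (iter i par n)).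
Proof.
(* [K] steps, each losing at most [N], still end above [Z0 + N1 + D]. *)
exists (Z0 + N1 + D + K.+1 * N) => n Sn Zn.
have [[i [iK Hi Hmin]]|Hno] := pselect (exists i, [/\ i <= K, iter i par n < N &
    forall k, k < i -> N <= iter k par n]).
  case: i iK Hi Hmin => [|i] iK Hi Hmin; first by rewrite /= in Hi; lia.
  exists i; split; last by left.
  have H k : k <= i -> n <= iter k par n + k * N.
    elim: k => [|k IH] ki /=; first by lia.
    have Hk := IH (ltnW ki); have kN : k * N <= K * N by rewrite leq_mul2r; lia.
    have : N <= iter k.+1 par n := Hmin k.+1 ki.
    have [||?|?] := @par_near (iter k par n) (S_iter k Sn); rewrite /=; lia.
  have : i * N <= K * N by rewrite leq_mul2r; lia.
  by have := H i (leqnn _); lia.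
have no_fall i : i <= K -> N <= iter i par n.
  elim/ltn_ind: i => i IH iK; rewrite leqNgt; apply/negP => Hi; apply: Hno.
  by exists i; split=> // k ki; apply: IH; lia.
have low i : i <= K -> n <= iter i par n + i * N.
  elim: i => [|i IH] iK /=; first by lia.
  have Hi := IH (ltnW iK); have kN : i * N <= K * N by rewrite leq_mul2r; lia.
  have := no_fall i.+1 iK.
  have [||?|?] := @par_near (iter i par n) (S_iter i Sn); rewrite /=; lia.
have low1 i : i <= K -> Z0 + N1 + D + N <= iter i par n.
  move=> iK; have : i * N <= K * N by rewrite leq_mul2r; lia.
  by have := low i iK; lia.
have mod_lt m : m %% K < K by rewrite ltn_pmod.
have [u [v [uv vK Euv]]] := pigeonhole (fun i => Ordinal (mod_lt (iter i par n))).
rewrite card_ord in vK; move/(congr1 val): Euv => /= Euv.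
pose p := v - u; pose a := iter u par n.
have Ea i : iter i par a = iter (i + u) par n by rewrite iterD.
have a_ge i : i <= p -> Z0 + N1 + D + N <= iter i par a.
  by move=> ip; rewrite Ea; apply: low1; rewrite /p in ip; lia.
have Sa : S a := S_iter u Sn.
have Ep : iter p par a = iter v par n by rewrite Ea /p subnK // ltnW.
have p_gt0 : 0 < p by rewrite /p; lia.
exists u; split; first by have := a_ge 0 (leq0n _); rewrite /= /a; lia.
right; case: (leqP a (iter p par a)) => Hap.
  have [k Ek] : exists k, iter p par a = a + k * K.
    have /dvdnP[k Ek] : K %| iter p par a - a.
      by rewrite -eqn_mod_dvd // Ep -Euv.
    by exists k; rewrite -Ek subnKC.
  (* Translation repeats the segment upwards for ever, so the path would never come down to [r]. *)
  have Hj j : iter (j * p) par a = a + j * (k * K).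
    elim: j => [|j IH]; first by rewrite addn0.
    rewrite mulSn iterD IH mulnA iter_shift //.
    - by rewrite Ek; lia.
    - by move=> i ip; have := a_ge i (ltnW ip); lia.
    - by have := a_ge p (leqnn _); lia.
  have [s Hs] := par_root Sa; exfalso.
  have : iter (s * p) par a = r.
    by rewrite -(subnK (leq_pmulr s p_gt0)) iterD Hs iter_r.
  by rewrite Hj; have := a_ge 0 (leq0n _); rewrite /=; lia.
have [k Ek] : exists k, iter p par a + k * K = a.
  have /dvdnP[k Ek] : K %| a - iter p par a.
    by rewrite -eqn_mod_dvd 1?ltnW // Ep Euv.
  by exists k; rewrite -Ek subnKC // ltnW.
have k_gt0 : 0 < k by case: k Ek => // Ek; lia.
(* At most [K] steps, each losing at most [N], descend by [k * K]. *)
have kN : k <= N.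
  have := low v vK; have := low u (leq_trans (ltnW uv) vK); rewrite -Ep -/a => H1 H2.
  have H3 i : i <= p -> a <= iter i par a + i * N.
    elim: i => [|i IH] ip /=; first by lia.
    have Hi := IH (ltnW ip); have Hg := a_ge i (ltnW ip).
    have := a_ge i.+1 ip.
    have [||?|?] := @par_near (iter i par a) (S_iter i Sa); rewrite /=; lia.
  have := H3 p (leqnn _); have pK : p * N <= K * N by rewrite leq_mul2r /p; lia.
  rewrite -{1}Ek => H4; have : k * K <= N * K by rewrite [N * K]mulnC; lia.
  by rewrite leq_pmul2r.
have /dvdnP[M EM] : k %| N`! by apply: dvdn_fact; rewrite k_gt0.
(* The segment, translated downwards, is run [M] times; the total descent [M * k * K] is [D]. *)
have Hj j : j <= M -> iter (j * p) par a + j * k * K = a.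
  elim: j => [|j IH] jM; first by rewrite addn0.
  have {}IH := IH (ltnW jM).
  have jD : j * k * K <= D by rewrite /D EM leq_pmul2r // leq_pmul2r // ltnW.
  have [|_ /(_ p (leqnn _))] := @iter_unshift (j * k) a p Sa.
    by move=> i /a_ge; lia.
  have -> : a - j * k * K = iter (j * p) par a by lia.
  by rewrite [j.+1 * p]mulSn iterD [j.+1 * k]mulSn mulnDl; lia.
by exists (M * p); rewrite /D EM Hj.
Qed.

(** * Cut vertices, core and blocks *)

Variable Wb : nat.
Hypothesis Wb_ge : N1 + D <= Wb.
Hypothesis Wb_anc : forall a, a < N1 + D -> S a -> forall s, iter s par a < Wb.

(** The added [D] keeps [y - D] at or above [Wb] for every [y] at or above the cut level, so a path
    from [y] to [y - D] can still be translated. *)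
Definition cut_level := Wb + D.
Local Notation W := cut_level.

Lemma D_gt0 : 0 < D.
Proof. by rewrite muln_gt0 fact_gt0. Qed.

Lemma S_shiftD j n : N <= n -> (S (n + j * D) <-> S n).
Proof. by rewrite mulnA; apply: S_shift. Qed.

Lemma par_shiftD j n : S n -> N1 <= n -> par (n + j * D) = sh (j * D) (par n).
Proof. by rewrite mulnA; apply: par_shift. Qed.

(** After a visit below [N1 + D] a path stays below [Wb]. Hence paths ending at or above [Wb] can be
    translated by [D] both ways. *)
Lemma path_above s n i : S n -> Wb <= iter s par n -> i <= s -> N1 + D <= iter i par n.
Proof.
move=> Sn Hs Hi; rewrite leqNgt; apply/negP => H.
by have := Wb_anc H (S_iter i Sn) (s - i); rewrite -iterD subnK //; lia.
Qed.

Lemma path_up_le j s n i : S n -> Wb <= iter s par n -> i <= s ->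
  iter i par (n + j * D) = iter i par n + j * D.
Proof.
move=> Sn Hs si; rewrite mulnA; apply: iter_shift => //.
  by move=> k ki; have := path_above Sn Hs (leq_trans (ltnW ki) si); lia.
by have := path_above Sn Hs si; lia.
Qed.

Lemma path_up j s n : S n -> Wb <= iter s par n ->
  iter s par (n + j * D) = iter s par n + j * D.
Proof. by move=> Sn Hs; apply: path_up_le Hs _. Qed.

Lemma path_down s n : S n -> Wb <= iter s par n ->
  [/\ D <= n, S (n - D) & forall i, i <= s -> iter i par (n - D) + D = iter i par n].
Proof.
move=> Sn Hs; have [|H1 H2] := @iter_unshift N`! n s Sn.
  by move=> i; apply: path_above.
by split=> //; have := path_above Sn Hs (leq0n _); rewrite /=; lia.
Qed.

(* The cut vertices of index 0: tops of star branches within one period above the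
   level [W], and the last vertex above [W] on each periodic path.  Their translates
   [rep] are all the cut vertices. *)
Definition base y := [/\ S y, W <= y, forall s, 0 < s -> iter s par y < W
  & (par y < N /\ y < W + D) \/ recurrent y].

Definition rep n := exists y j, base y /\ n = y + j * D.

Lemma recurrent_base y : base y -> recurrent y ->
  exists t, [/\ 0 < t, iter t par y + D = y & Wb <= iter t par y].
Proof.
rewrite /W; move=> [Sy yW _ _] [t Ht]; exists t; have := D_gt0; split=> //.
  by case: t Ht => //=; lia.
by rewrite /W in yW; lia.
Qed.

Lemma recurrent_par y : base y -> recurrent y -> N <= par y.
Proof.
move=> By Ry; have [t [t0 _ Ht]] := recurrent_base By Ry; have [Sy _ _ _] := By.
by have := path_above Sy Ht t0; rewrite /=; lia.
Qed.

(** Concatenates translates of the path from [y] to [y - D]. *)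
Lemma base_ancestor y j : base y -> recurrent y ->
  exists s, 0 < s /\ iter s par (y + j.+1 * D) = y.
Proof.
move=> By Ry; have [t [t0 Et Ht]] := recurrent_base By Ry; have [Sy _ _ _] := By.
elim: j => [|j [s [s0 Es]]].
  by exists t; split=> //; rewrite path_up // mul1n.
exists (s + t); split; first by lia.
by rewrite iterD path_up // [j.+2 * D]mulSn addnA Et.
Qed.

(** Suppose [y] exceeds [y'] by a positive multiple of [D]. Then [y] is past the window of star
    tops, hence recurrent. So [par y] is not low, which forces [y'] to be recurrent too. Then [y']
    is a proper ancestor of [y] above the cut level, although [y] is the last such vertex on its
    path. *)
Lemma rep_inj y j y' j' : base y -> base y' -> y + j * D = y' + j' * D -> y = y' /\ j = j'.
Proof.
wlog: y j y' j' / j <= j'.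
  move=> H By By' E; case: (leqP j j') => [|/ltnW] Hj; first exact: H.
  by have [-> ->] := H _ _ _ _ Hj By' By (esym E).
move=> Hj By By' E; have [k Ek] : exists k, j' = j + k by exists (j' - j); lia.
have {}E : y = y' + k * D by rewrite Ek mulnDl in E; lia.
case: k Ek E => [|k] Ek E; first by split; lia.
have [Sy yW Hy Cy] := By; have [Sy' yW' Hy' Cy'] := By'.
case: Cy => [[_]|Ry]; first by rewrite E mulSn; lia.
case: Cy' => [[py _]|Ry'].
  have := recurrent_par By Ry; rewrite E par_shiftD //.
    by rewrite /shift_above py; lia.
  by rewrite /W in yW'; lia.
have [s [s0 Es]] := base_ancestor k By' Ry'.
by have := Hy s s0; rewrite E Es; lia.
Qed.

Lemma rep_S n : rep n -> S n.
Proof.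
move=> [y [j [[Sy yW _ _] ->]]]; apply/S_shiftD => //; rewrite /W in yW; lia.
Qed.

Lemma rep_W n : rep n -> W <= n.
Proof. by move=> [y [j [[_ yW _ _] ->]]]; lia. Qed.

(** A star top is brought by translation into the window from [W] to [W + D]. On a periodic path,
    the last vertex at or above [W] is a base vertex, and the path meets its translate by [D]
    earlier. *)
Lemma high_rep : exists Z, forall n, S n -> Z <= n ->
  exists i y j, [/\ base y, 0 < j & iter i par n = y + j * D].
Proof.
have [Z HZ] := star_or_recurrent (W + D).
exists Z => n Sn Zn; have [i [Hi Hc]] := HZ n Sn Zn.
have Sm := S_iter i Sn; rewrite iterS in Hc.
have [m Em] : exists m, iter i par n = m by exists (iter i par n).
rewrite Em in Sm Hi Hc; case: Hc => [pN|[t Et]].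
  have D0 := D_gt0.
  pose j := (m - W) %/ D; pose y := W + (m - W) %% D.
  have Ey : m = y + j * D by have := divn_eq (m - W) D; rewrite /y /j; lia.
  have yD : y < W + D by rewrite /y ltn_add2l ltn_pmod.
  have yW : W <= y by rewrite /y leq_addr.
  clearbody j y; have yN : N1 <= y by rewrite /W in yW; lia.
  have Sy : S y by apply/(@S_shiftD j); [lia|rewrite -Ey].
  have py : par y < N.
    move: pN; rewrite Ey par_shiftD // /shift_above.
    by case: (ltnP (par y) N) => // ? ?; lia.
  exists i, y, j; split=> //; [|by case: j Ey => //; lia|by rewrite Em].
  split=> //; last by left.
  case=> // s _; rewrite iterSr.
  by have := @Wb_anc (par y) ltac:(lia) (S_par Sy) s; rewrite /W; lia.
have [s Es] : exists s, W <= iter s par m /\ forall s', s < s' -> iter s' par m < W.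
  have [s0 Hs0] := par_root Sm.
  have HW s : s0 <= s -> iter s par m < W.
    by move=> H; rewrite -(subnK H) iterD Hs0 iter_r /W; lia.
  have P0 : exists s, W <= iter s par m by exists 0; rewrite /=; lia.
  have Pm s : W <= iter s par m -> s <= s0.
    by move=> H; rewrite leqNgt; apply/negP => /ltnW/HW; lia.
  case: (ex_maxnP P0 Pm) => s Hs Hmax; exists s; split=> // s' ss'.
  by rewrite ltnNge; apply/negP => /Hmax; lia.
case: Es => ys ylast; have ts : t <= s.
  by rewrite leqNgt; apply/negP => /ylast; lia.
have yb : Wb <= iter s par m by rewrite /W in ys; lia.
have Emt : m - D = iter t par m by lia.
have [_ _ /(_ s (leqnn _)) Ed] := path_down Sm yb.
(* The path from [m - D] reaches the base vertex in [s - t] steps, so the path from [m] reaches its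
   translate by [D] in as many. *)
exists (i + (s - t)), (iter s par m), 1; split=> //.
  split=> //; first exact: S_iter.
    by move=> s' s'0; rewrite -iterD; apply: ylast; lia.
  by right; exists t; rewrite -iterD [t + s]addnC iterD -Emt.
rewrite addnC iterD Em -{1}Et -[D in LHS]mul1n path_up //.
- by rewrite -iterD subnK.
- exact: S_iter.
by rewrite -iterD subnK.
Qed.

(* [core] is the finite part left after cutting; [top v y j] says that [v] belongs
   to the block hanging below the cut vertex [y + j * D]. *)
Definition core v := S v /\ forall s, ~ rep (iter s par v).

Definition top v y j := [/\ S v, base y &
  exists s, iter s par v = y + j * D /\ forall i, i < s -> ~ rep (iter i par v)].

Lemma core_or_top v : S v -> core v \/ exists y j, top v y j.
Proof.
move=> Sv; have [H|H] := pselect (exists s, `[< rep (iter s par v) >]).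
  right; case: (ex_minnP H) => s /asboolP[y [j [By E]]] Hmin.
  exists y, j; split=> //; exists s; split=> // i si Ri.
  by have := Hmin i; rewrite leqNgt si => /(_ _)/negP[] //; apply/asboolP.
by left; split=> // s Rs; apply: H; exists s; apply/asboolP.
Qed.

Lemma rep_base y j : base y -> rep (y + j * D).
Proof. by move=> By; exists y, j. Qed.

Lemma top_core v y j : top v y j -> core v -> False.
Proof. by move=> [_ By [s [Es _]]] [_ /(_ s)]; rewrite Es; apply; apply: rep_base. Qed.

Lemma top_inj v y j y' j' : top v y j -> top v y' j' -> y = y' /\ j = j'.
Proof.
move=> [_ By [s [Es Hs]]] [_ By' [s' [Es' Hs']]]; apply: rep_inj => //.
have R1 := rep_base j By; have R2 := rep_base j' By'.
case: (ltngtP s s') => H; last by rewrite -Es -Es' H.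
- by case: (Hs' s H); rewrite Es.
- by case: (Hs s' H); rewrite Es'.
Qed.

Lemma top_base y j : base y -> top (y + j * D) y j.
Proof. by move=> By; split=> //; [apply/rep_S/rep_base|exists 0]. Qed.

Lemma top_par v y j : top v y j -> v <> y + j * D -> top (par v) y j.
Proof.
move=> [Sv By [[|s] [Es Hs]]] Ev //; split=> //; first exact: S_par.
exists s; rewrite -iterSr; split=> // i si; rewrite -iterSr; exact: Hs.
Qed.

Lemma core_par v : core v -> core (par v).
Proof.
by move=> [Sv Hv]; split; [apply: S_par|move=> s; rewrite -iterSr].
Qed.

Lemma core_base_par y : base y -> core (par y).
Proof.
move=> [Sy _ Hy _]; split; first exact: S_par.
by move=> s; rewrite -iterSr => /rep_W; have := Hy s.+1 isT; lia.
Qed.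

Lemma core_root : core r.
Proof.
split=> // s; rewrite iter_r => /rep_W; rewrite /W; lia.
Qed.

Lemma base_proper y y' j s : base y -> 0 < s -> base y' -> iter s par y <> y' + j * D.
Proof.
move=> [_ _ Hy _] s0 By' E; have := Hy s s0; rewrite E.
by have := rep_W (rep_base j By'); lia.
Qed.

(** An earlier cut vertex of positive index would translate back to one on the old path; one of
    index 0 would have the proper ancestor [y + j.+1 * D], against [base_proper]. *)
Lemma top_up v y j : top v y j -> top (v + D) y j.+1.
Proof.
move=> [Sv By [s [Es Hs]]]; have [Sy yW _ _] := By.
have Hb : Wb <= iter s par v by rewrite Es; rewrite /W in yW; lia.
have up i : i <= s -> iter i par (v + D) = iter i par v + D.
  by move=> si; have := path_up_le 1 Sv Hb si; rewrite !mul1n.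
split=> //; first by rewrite -[D]mul1n; apply/S_shiftD => //;
  have := path_above Sv Hb (leq0n _); rewrite /=; lia.
exists s; split; first by rewrite up // Es mulSn addnAC addnA.
move=> i si; rewrite up 1?ltnW // => -[y' [[|j'] [By' E]]].
  apply: (@base_proper y' y j.+1 (s - i)) => //; first by rewrite subn_gt0.
  have -> : y' = iter i par (v + D) by rewrite up 1?ltnW // E addn0.
  by rewrite -iterD subnK 1?ltnW // up // Es mulSn addnAC addnA.
by case: (Hs i si); exists y', j'; split=> //; rewrite mulSn in E; lia.
Qed.

Lemma top_down v y j : top v y j.+1 -> D <= v /\ top (v - D) y j.
Proof.
move=> [Sv By [s [Es Hs]]]; have [Sy yW _ _] := By.
have Hb : Wb <= iter s par v by rewrite Es; rewrite /W in yW; lia.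
have [Dv Sd down] := path_down Sv Hb; split=> //; split=> //.
exists s; split; first by have := down s (leqnn _); rewrite Es mulSn; lia.
move=> i si [y' [j' [By' E]]]; case: (Hs i si); exists y', j'.+1; split=> //.
by rewrite -down 1?ltnW // E mulSn; lia.
Qed.

Lemma top_shift v y j : top v y 0 -> top (v + j * D) y j.
Proof.
move=> Ht; elim: j => [|j /top_up]; first by rewrite addn0.
by rewrite mulSn -addnA [D + _]addnC.
Qed.

Lemma top_unshift v y j : top v y j -> exists v0, top v0 y 0 /\ v = v0 + j * D.
Proof.
elim: j v => [|j IH] v Ht; first by exists v; rewrite addn0.
have [Dv /IH[v0 [Ht0 E]]] := top_down Ht.
by exists v0; split=> //; rewrite mulSn; lia.
Qed.

(** By [high_rep] a high vertex meets a cut vertex of positive index. It is then outside the core,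
    and its first cut vertex cannot have index 0, whose proper ancestors are all below the cut
    level. *)
Lemma core_top_bounded : exists Z,
  (forall v, core v -> v < Z) /\ (forall v y, top v y 0 -> v < Z).
Proof.
have [Z HZ] := high_rep; exists Z; split.
  move=> v [Sv Hv]; rewrite ltnNge; apply/negP => /(HZ v Sv)[i [y [j [By _ E]]]].
  by apply: (Hv i); rewrite E; apply: rep_base.
move=> v y [Sv By [s [Es Hs]]]; rewrite ltnNge; apply/negP.
move=> /(HZ v Sv)[i [y' [j [By' j0 E]]]]; rewrite addn0 in Es.
case: (ltngtP i s) => His.
- by apply: (Hs i His); rewrite E; apply: rep_base.
- apply: (@base_proper y y' j (i - s)) => //; first by rewrite subn_gt0.
  by rewrite -Es -iterD subnK 1?ltnW.
have [] := @rep_inj y 0 y' j By By'; last by lia.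
by rewrite addn0 -E -Es His.
Qed.

Lemma top_ge v y j : top v y j -> N1 + D <= v.
Proof.
move=> [Sv [Sy yW _ _] [s [Es Hs]]].
have Hb : Wb <= iter s par v by rewrite Es; rewrite /W in yW; lia.
exact: (path_above Sv Hb (leq0n _)).
Qed.

(** Decides where copy 1 of the block hangs: at the same low vertex for a star, inside copy 0 for a
    periodic path. *)
Lemma next_base y : base y ->
  (par y < N /\ par (y + D) = par y) \/ (N <= par y /\ top (par (y + D)) y 0).
Proof.
move=> By; have [Sy yW Hy Cy] := By.
have yN1 : N1 <= y by rewrite /W in yW; lia.
case: (ltnP (par y) N) => py; [left|right]; split=> //.
  by rewrite -[D]mul1n par_shiftD // /shift_above py.
have Ry : recurrent y by case: Cy => // -[]; lia.
have [t [t0 Et Ht]] := recurrent_base By Ry.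
have up i : i <= t -> iter i par (y + D) = iter i par y + D.
  by move=> si; have := path_up_le 1 Sy Ht si; rewrite !mul1n.
case: t t0 Et Ht up => // t _ Et Ht up.
split=> //; first by apply: S_par; rewrite -[D]mul1n; apply/S_shiftD => //; lia.
exists t; split; first by rewrite -iterSr up // Et addn0.
move=> i it; rewrite -iterSr up 1?ltnS 1?ltnW // => -[y' [[|j'] [By' E]]].
  apply: (@base_proper y' y 0 (t - i)) => //; first by rewrite subn_gt0.
  have -> : y' = iter i.+1 par (y + D) by rewrite up 1?ltnS 1?ltnW // E addn0.
  by rewrite -iterD addnS subnK 1?ltnW // up // Et addn0.
by apply: (@base_proper y y' j' i.+1) => //; rewrite mulSn in E; lia.
Qed.

(** An end below [N] stays fixed; the bound [N + N] on the other end supplies the separation that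
    periodicity away from the diagonal requires. *)
Lemma e_shift j s t : (N <= s /\ N <= t) \/ (s < N /\ N + N <= t) \/ (t < N /\ N + N <= s) ->
  (e (sh (j * D) s) (sh (j * D) t) <-> e s t).
Proof.
rewrite mulnA; have [H1 H2 H3] := periodic2_weaken (j * N`!) e_per (leqnn _).
rewrite /shift_above; case=> [[Hs Ht]|[[Hs Ht]|[Ht Hs]]].
- by rewrite !ltnNge Hs Ht H1.
- by rewrite Hs ltnNge (leq_trans _ Ht) ?leq_addr //= H2 //; lia.
- by rewrite Ht ltnNge (leq_trans _ Hs) ?leq_addr //= H3 //; lia.
Qed.

(** * Templates from blocks and the isomorphism *)

Variables (X : Type) (E : X -> X -> Prop) (phi : nat -> X).
Hypothesis E_tree : directed_tree E.
Hypothesis phi_inj : forall m n, S m -> S n -> phi m = phi n -> m = n.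
Hypothesis phi_surj : forall x, exists n, S n /\ phi n = x.
Hypothesis eE : forall m n, e m n <-> [/\ S m, S n & E (phi m) (phi n)].

Variable Z : nat.
Hypothesis Z_core : forall v, core v -> v < Z.
Hypothesis Z_top : forall v y, top v y 0 -> v < Z.

(** [Z] bounds the core and the blocks of index 0, so they become finite types without losing a
    vertex. *)
Definition below (P : nat -> Prop) := {x : 'I_Z | `[< P x >]}.

Definition bval P (x : below P) : nat := val (val x).

Definition bmk (P : nat -> Prop) n (nZ : n < Z) (Pn : P n) : below P :=
  exist (fun x : 'I_Z => `[< P x >]) (Ordinal nZ) (introT (asboolP (P n)) Pn).

Lemma bvalP P (x : below P) : P (bval x).
Proof. exact/asboolP/(valP x). Qed.

Lemma bval_inj P : injective (@bval P).
Proof. by move=> x y /val_inj/val_inj. Qed.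

Definition below_edge P : rel (below P) := fun a b => `[< e (bval a) (bval b) >].

Lemma e_irr n : ~ und e n n.
Proof. by have [_ irr _ _ _] := E_tree; case=> /eE[_ _ /irr]. Qed.

Lemma und_below P (a b : below P) :
  und (fun a b => below_edge a b) a b <-> und e (bval a) (bval b).
Proof. by split; case=> /asboolP; [left|right|left|right]. Qed.

Lemma below_tree (P : nat -> Prop) (t : below P) : (forall n, P n -> S n) ->
  (forall n, P n -> n <> bval t -> n <> r /\ P (par n) /\ par n < Z) ->
  directed_tree (fun a b : below P => below_edge a b).
Proof.
move=> PS Ppar; apply: (@induced_tree _ _ E _ (fun a => phi (bval a)) t (fun a => dep (bval a))).
- exact: E_tree.
- by move=> a b /phi_inj H; apply/bval_inj/H; apply: PS; apply: bvalP.
- move=> a b; split=> [/asboolP/eE[]//|H]; apply/asboolP/eE.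
  by split=> //; apply: PS; apply: bvalP.
move=> a; have [->|/eqP Na] := eqVneq a t; [by left|right].
have Sa := PS _ (bvalP a).
have [|ar [Pp Zp]] := Ppar _ (bvalP a); first by move/bval_inj.
exists (bmk Zp Pp); split; last by rewrite [X in _ < X]par_dep.
by apply/und_below; apply: par_edge.
Qed.

(* The template vertices: the block of [y] together with the parent [par y] of its
   top, which serves as the leaf [t0]; the other end is [par (y + D)], equal to
   [par y] exactly for stars. *)
Definition block y n := n = par y \/ top n y 0.

Lemma base_lt y : base y -> y < Z.
Proof. by move=> By; apply: (@Z_top y y); have := top_base 0 By; rewrite addn0. Qed.

Lemma top_base0 y : base y -> top y y 0.
Proof. by move=> By; have := top_base 0 By; rewrite addn0. Qed.

Lemma block_lt y n : base y -> block y n -> n < Z.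
Proof. by move=> By [->|/Z_top//]; apply/Z_core/core_base_par. Qed.

Lemma block_S y n : base y -> block y n -> S n.
Proof. by move=> [Sy _ _ _] [->|[]//]; apply: S_par. Qed.

Lemma block_t1 y : base y -> block y (par (y + D)).
Proof. by move=> By; case: (next_base By) => -[_]; [left|right]. Qed.

Lemma block_par y v : base y -> top v y 0 -> block y (par v).
Proof.
move=> By Tv; have [->|/eqP vy] := eqVneq v y; [by left|right].
by apply: top_par => //; rewrite addn0.
Qed.

Lemma block_shift y s t j : block y s -> block y t -> s <> t ->
  (e (sh (j * D) s) (sh (j * D) t) <-> e s t).
Proof.
move=> Bs Bt st; apply: e_shift.
case: Bs Bt => [Es|/top_ge Hs] [Et|/top_ge Ht]; lia.
Qed.

Definition block_template y (By : base y) : template :=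
  @Template (below (block y)) (@below_edge (block y))
    (bmk (block_lt By (or_introl erefl)) (or_introl erefl))
    (bmk (block_lt By (block_t1 By)) (block_t1 By)).

(** A vertex topped by [y], other than [y], has its parent topped by [y], and the parent of [par y]
    is in the core; so [y] is the only neighbour of [par y] in the block. *)
Lemma block_template_valid y (By : base y) : valid_template (block_template By).
Proof.
have [Sy yW _ _] := By; have yN := top_ge (top_base0 By).
have yr : y <> r by lia.
split.
  apply: (@below_tree (block y) (tt0 (block_template By))) => [n|n Bn].
    exact: block_S.
  rewrite -[bval _]/(par y) => Nn; have Tn : top n y 0 by case: Bn.
  have Bp := block_par By Tn.
  by have := top_ge Tn; split; [lia|split=> //; apply: block_lt Bp].
have By' : block y y by right; apply: top_base0.
exists (@bmk (block y) y (block_lt By By') By'); split.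
  by apply/und_below; apply: und_sym; apply: par_edge.
move=> w Hw; have {}Hw : und e (par y) (@bval (block y) w).
  exact: (@und_below (block y) (tt0 (block_template By)) w).1 Hw.
apply: (@bval_inj (block y)); rewrite -[RHS]/y.
move: (@bval (block y) w) Hw (@bvalP (block y) w) => {}w Hw [Ew|Tw].
  by rewrite -Ew in Hw; case: (e_irr Hw).
have Cp := core_base_par By.
case: (edge_par Hw) => -[_ Ew].
  by case: (top_core Tw); rewrite -Ew; apply: core_par.
apply: contrapT => wy; apply: (@top_core (par w) y 0); last by rewrite Ew.
by apply: top_par => //; rewrite addn0.
Qed.

Definition base_index := below base.

Definition index_base (i : 'I_#|{: base_index}|) : nat := bval (enum_val i).

Lemma index_baseP i : base (index_base i).
Proof. exact: bvalP. Qed.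

Lemma index_base_inj : injective index_base.
Proof. by move=> i j /bval_inj/enum_val_inj. Qed.

Lemma index_base_surj y : base y -> exists i, index_base i = y.
Proof.
move=> By; exists (enum_rank (bmk (base_lt By) By)).
by rewrite /index_base enum_rankK.
Qed.

Definition blocks i := block_template (index_baseP i).

Definition attach i : below core :=
  bmk (Z_core (core_base_par (index_baseP i))) (core_base_par (index_baseP i)).

Local Notation pv := (pre_vertex (below core) blocks).

(** With [sh], all copies of a star centre, which is low, get one code, while the leaf of a path
    copy lands on [tt1] of the previous copy. *)
Definition code (u : pv) : nat :=
  match u with
  | inl a => bval a
  | inr (existT i (j, t)) => sh (j * D) (bval (t : below (block (index_base i))))
  end.

Lemma code_S u : S (code u).
Proof.
case: u => [a|[i [j t]]] /=; first by have [] := bvalP a.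
have St := block_S (index_baseP i) (bvalP t).
by rewrite /shift_above; case: ltnP => // H; apply/S_shiftD.
Qed.

Lemma shift_top v y j : top v y 0 -> sh (j * D) v = v + j * D.
Proof. by move=> /top_ge H; rewrite /shift_above ltnNge (_ : N <= v) //; lia. Qed.

(** Leaves [tt0] are dropped, so each gluing class keeps exactly one vertex. *)
Definition reduced (u : pv) : Prop :=
  if u is inr (existT i (j, t)) then
    top (bval (t : below (block (index_base i)))) (index_base i) 0
  else True.

Lemma reduced_inj u v : reduced u -> reduced v -> code u = code v -> u = v.
Proof.
case: u => [a|[i [j t]]]; case: v => [b|[i' [j' t']]] //= Tu Tv.
- by move/bval_inj ->.
- rewrite (shift_top _ Tv) => Ea; case: (top_core (top_shift j' Tv)).
  by rewrite -Ea; apply: bvalP.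
- rewrite (shift_top _ Tu) => Ea; case: (top_core (top_shift j Tu)).
  by rewrite Ea; apply: bvalP.
rewrite (shift_top _ Tv) (shift_top _ Tu) => Ec.
have T1 := top_shift j Tu; rewrite Ec in T1.
have [/index_base_inj Ei Ej] := top_inj T1 (top_shift j' Tv).
subst i' j'; have /bval_inj -> // : bval t = bval t' by lia.
Qed.

Lemma reduced_exists u :
  exists u', reduced u' /\ clos_refl_sym_trans pv (glue attach) u u'.
Proof.
case: u => [a|[i [j t]]]; first by exists (inl a); split=> //; apply: rst_refl.
have Bi := index_baseP i.
case: (bvalP t : block (index_base i) (bval t)) => [Et|Tt]; last first.
  by exists (cp _ i j t); split=> //; apply: rst_refl.
have {Et} -> : t = tt0 (blocks i) by apply: bval_inj.
elim: j => [|j [u' [Ru' Hu']]].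
  exists (inl (attach i)); split=> //; apply: rst_sym; apply: rst_step.
  by right; exists i.
have step : clos_refl_sym_trans pv (glue attach)
    (cp _ i j.+1 (tt0 (blocks i))) (cp _ i j (tt1 (blocks i))).
  by apply: rst_sym; apply: rst_step; left; exists i, j.
case: (next_base Bi) => [[_ Ep]|[_ Tp]].
  exists u'; split=> //; apply: rst_trans step _.
  have -> // : tt1 (blocks i) = tt0 (blocks i) by apply: bval_inj.
by exists (cp _ i j (tt1 (blocks i))).
Qed.

Lemma code_glue u v : clos_refl_sym_trans pv (glue attach) u v -> code u = code v.
Proof.
elim=> // [{}u {}v|? ? ? _ -> _ ->] //.
case=> [[i [j [-> ->]]]|[i [-> ->]]] /=; last first.
  by rewrite /shift_above mul0n addn0 if_same.
have [Sy yW _ _] := index_baseP i; have yN := top_ge (top_base0 (index_baseP i)).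
change (sh (j * D) (par (index_base i + D)) = sh (j.+1 * D) (par (index_base i))).
have -> : par (index_base i + D) = sh D (par (index_base i)).
  by have := @par_shiftD 1 _ Sy; rewrite !mul1n; apply; lia.
rewrite /shift_above mulSn; case: (ltnP (par _)) => H; first by rewrite H.
by rewrite ltnNge (leq_trans H) ?leq_addr //= addnA.
Qed.

(** As a block contains the parent of its top, every parent edge lies in the core or in a single
    copy of a block. *)
Lemma code_parent_edge c : S c -> c <> r -> exists u v : pv,
  [/\ code u = c, code v = par c,
      e c (par c) -> pre_edge (@below_edge core) u v
    & e (par c) c -> pre_edge (@below_edge core) v u].
Proof.
move=> Sc cr; case: (core_or_top Sc) => [Cc|[y [j Tc]]].
  have Cp := core_par Cc.
  exists (inl (bmk (Z_core Cc) Cc)), (inl (bmk (Z_core Cp) Cp)); split=> // H;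
  by left; do 2 eexists; split; [reflexivity|reflexivity|apply/asboolP].
have [_ By _] := Tc; have [i Ei] := index_base_surj By; subst y.
have [v0 [Tv Ec]] := top_unshift Tc.
have Bv : block (index_base i) v0 by right.
have Bp := block_par By Tv.
have Sv : S v0 by case: Tv.
have vr : v0 <> r by have := top_ge Tv; lia.
have vp : v0 <> par v0 by move=> Ev; apply: (@e_irr v0); rewrite {2}Ev; apply: par_edge.
have Epar : sh (j * D) (par v0) = par c.
  by rewrite Ec par_shiftD //; have := top_ge Tv; lia.
have Esh : sh (j * D) v0 = c by rewrite (shift_top _ Tv).
exists (@cp _ _ blocks i j (@bmk (block (index_base i)) v0 (block_lt By Bv) Bv)),
  (@cp _ _ blocks i j (@bmk (block (index_base i)) (par v0) (block_lt By Bp) Bp)); split=> //.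
  rewrite -Epar -Esh (block_shift j Bv Bp vp) => H; right.
  by do 4 eexists; split; [reflexivity|reflexivity|apply/asboolP].
rewrite -Epar -Esh (block_shift j Bp Bv (nesym vp)) => H; right.
by do 4 eexists; split; [reflexivity|reflexivity|apply/asboolP].
Qed.

Lemma core_tree : directed_tree (fun a b : below core => below_edge a b).
Proof.
have C0 := core_root.
apply: (@below_tree core (bmk (Z_core C0) C0)) => [n []|n Cn Nn] //.
by split=> //; split; [apply: core_par|apply/Z_core/core_par].
Qed.

Lemma blocks_iso : iso_to_attached E (@below_edge core) blocks attach.
Proof.
have code_eq u v : code u = code v <-> clos_refl_sym_trans pv (glue attach) u v.
  split; last exact: code_glue.
  have [u' [Ru Hu]] := reduced_exists u; have [v' [Rv Hv]] := reduced_exists v.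
  rewrite (code_glue Hu) (code_glue Hv) => /(reduced_inj Ru Rv) E'.
  by apply: rst_trans Hu _; rewrite E'; apply: rst_sym.
exists (phi \o code); split.
- move=> x; have [n [Sn <-]] := phi_surj x.
  have [->|/eqP nr] := eqVneq n r.
    by exists (inl (bmk (Z_core core_root) core_root)).
  by have [u [v [Eu _ _ _]]] := code_parent_edge Sn nr; exists u; rewrite /= Eu.
- move=> u v; rewrite -code_eq; split=> [/phi_inj H|/= ->] //.
  by apply: H; apply: code_S.
move=> x y; split.
  have [m [Sm <-]] := phi_surj x; have [n [Sn <-]] := phi_surj y => Emn.
  have emn : e m n by apply/eE.
  have : und e m n by left.
  case/edge_par => -[nr Ep].
    have [u [v [Eu Ev H _]]] := code_parent_edge Sm nr.
    by exists u, v; rewrite /= Eu Ev Ep; split=> //; apply: H; rewrite Ep.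
  have [u [v [Eu Ev _ H]]] := code_parent_edge Sn nr.
  by exists v, u; rewrite /= Eu Ev Ep; split=> //; apply: H; rewrite Ep.
move=> [u [v [<- <- []]]].
  by move=> [a [b [-> -> /asboolP/eE[]]]].
move=> [i [j [s [t [-> -> /asboolP H]]]]] /=.
have st : bval s <> bval t.
  by move=> Est; apply: (@e_irr (bval s)); left; rewrite {2}Est.
by move: H; rewrite -(block_shift j (bvalP s) (bvalP t) st) => /eE[].
Qed.

End PeriodicTree.

Lemma periodic_tree_attached (S : nat -> Prop) (e : nat -> nat -> Prop) (K N : nat)
    (X : Type) (E : X -> X -> Prop) (phi : nat -> X) :
  0 < K -> periodic1 N K S -> periodic2 N K e -> directed_tree E ->
  (forall m n, S m -> S n -> phi m = phi n -> m = n) ->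
  (forall x, exists n, S n /\ phi n = x) ->
  (forall m n, e m n <-> [/\ S m, S n & E (phi m) (phi n)]) ->
  exists (F : finType) (EF : rel F) (n : nat) (A : 'I_n -> template) (att : 'I_n -> F),
    [/\ directed_tree (fun a b : F => EF a b), (forall i, valid_template (A i))
      & iso_to_attached E EF A att].
Proof.
move=> K_gt0 S_per e_per E_tree phi_inj phi_surj eE.
have [[x0] _ _ _ _] := E_tree.
have [parX [depX [[parX0 depX0] parX_dep parX_edge edge_parX]]] := rooted_tree x0 E_tree.
have [rho Hrho] := choice phi_surj.
have rho_S x : S (rho x) by case: (Hrho x).
have rhoK x : phi (rho x) = x by case: (Hrho x).
have phiK n : S n -> rho (phi n) = n by move=> Sn; apply: phi_inj.
pose r := rho x0; pose par n := rho (parX (phi n)); pose dep n := depX (phi n).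
have und_e m n : und e m n <-> [/\ S m, S n & und E (phi m) (phi n)].
  split=> [[/eE[Sm Sn H]|/eE[Sn Sm H]]|[Sm Sn [H|H]]].
  - by split=> //; left.
  - by split=> //; right.
  - by left; apply/eE.
  - by right; apply/eE.
have phi_r n : S n -> n <> r -> phi n <> x0.
  by move=> Sn nr E0; apply: nr; rewrite /r -E0 phiK.
have par_r : par r = r by rewrite /par rhoK parX0.
have S_par n : S n -> S (par n) by move=> _; apply: rho_S.
have par_dep n : S n -> n <> r -> dep n = (dep (par n)).+1.
  by move=> Sn nr; rewrite /dep /par rhoK; apply/parX_dep/phi_r.
have par_edge n : S n -> n <> r -> und e n (par n).
  move=> Sn nr; apply/und_e; split=> //; first exact: S_par.
  by rewrite /par rhoK; apply/parX_edge/phi_r.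
have edge_par m n : und e m n -> (m <> r /\ par m = n) \/ (n <> r /\ par n = m).
  case/und_e=> Sm Sn /edge_parX[[H1 H2]|[H1 H2]]; [left|right]; split.
  - by move=> Er; apply: H1; rewrite Er rhoK.
  - by rewrite /par H2 phiK.
  - by move=> Er; apply: H1; rewrite Er rhoK.
  - by rewrite /par H2 phiK.
have edge_S m n : und e m n -> S m /\ S n by case/und_e.
have [N1 [NN1 r_N1 par_shiftK]] :=
  par_shift_bounded K_gt0 S_per e_per par_r S_par par_dep par_edge edge_par.
have [W0 HW0] := ancestors_bounded K_gt0 par_r S_par par_dep (N1 + long_period K N).
pose Wb := W0 + (N1 + long_period K N).
have Wb_ge : N1 + long_period K N <= Wb by rewrite /Wb leq_addl.
have Wb_anc a : a < N1 + long_period K N -> S a -> forall s, iter s par a < Wb.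
  by move=> Ha Sa s; rewrite /Wb ltn_addr // HW0.
have [Z [Z_core Z_top]] := core_top_bounded K_gt0 S_per e_per par_r S_par par_dep
  par_edge edge_par edge_S NN1 r_N1 par_shiftK Wb_ge Wb_anc.
do 5 eexists; split; last exact: (blocks_iso K_gt0 S_per e_per (rho_S x0) par_r S_par
  par_edge edge_par NN1 r_N1 par_shiftK Wb_ge Wb_anc E_tree phi_inj phi_surj eE
  Z_core Z_top).
  exact: (core_tree K_gt0 (rho_S x0) par_r S_par par_dep par_edge NN1 r_N1 Wb_ge
    E_tree phi_inj eE Z_core).
by move=> i; apply: (block_template_valid K_gt0 S_per par_r S_par par_dep par_edge
  edge_par NN1 r_N1 par_shiftK Wb_ge Wb_anc E_tree phi_inj eE).
Qed.

(** * Minimal codes *)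

(** In a residue class modulo [K], one failure beyond [q] persists, so [P] is eventually constant
    there; the largest threshold over the finitely many classes serves. *)
Lemma antitone_periodic (P : nat -> Prop) q K : 0 < K ->
  (forall n, q <= n -> P (n + K) -> P n) -> exists q', periodic1 q' K P.
Proof.
move=> K_gt0 anti.
have col c : exists b, forall j, b <= j -> (P (c + j * K + K) <-> P (c + j * K)).
  have [[j0 [Hq Hj0]]|H] := pselect (exists j, q <= c + j * K /\ ~ P (c + j * K)).
    have fails j : j0 <= j -> ~ P (c + j * K).
      move=> Hj; rewrite -(subnKC Hj); elim: (j - j0) => [|d IH]; first by rewrite addn0.
      rewrite addnS mulSn => Pd; apply: IH; apply: anti; first by rewrite mulnDl; lia.
      by rewrite -addnA [_ * K + K]addnC.
    exists j0 => j Hj; have := fails j Hj; have := fails j.+1 (leqW Hj).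
    by rewrite mulSn [K + _]addnC addnA.
  exists q => j Hj.
  have qj : q <= j * K by apply: leq_trans Hj _; rewrite leq_pmulr.
  have all_P j' : q <= c + j' * K -> P (c + j' * K).
    by move=> H'; apply: contrapT => NP; apply: H; exists j'.
  split=> _; first by apply: all_P; lia.
  by have := all_P j.+1; rewrite mulSn [K + _]addnC addnA; apply; lia.
have [b Hb] : exists b, forall c, c < K -> forall j, b <= j ->
    (P (c + j * K + K) <-> P (c + j * K)).
  elim: {1}K => [|k [b Hb]]; first by exists 0.
  have [b' Hb'] := col k; exists (maxn b b') => c; rewrite ltnS leq_eqVlt => /orP[/eqP->|ck] j Hj.
    by apply: Hb'; lia.
  by apply: Hb => //; lia.
exists (b * K) => n Hn; have := Hb (n %% K) (ltn_pmod n K_gt0) (n %/ K).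
by rewrite [n %% K + _]addnC -divn_eq; apply; rewrite leq_divRL.
Qed.

(** A smaller code of the vertex of [n] translates to a smaller code for [n + K], so minimality
    passes down from [n + K] to [n] and [antitone_periodic] applies. *)
Lemma presentable_periodic (X : Type) (E : X -> X -> Prop) :
  unary_FA_presentable E ->
  exists (S : nat -> Prop) (e : nat -> nat -> Prop) (K N : nat) (phi : nat -> X),
    [/\ 0 < K, periodic1 N K S /\ periodic2 N K e,
        forall m n, S m -> S n -> phi m = phi n -> m = n,
        forall x, exists n, S n /\ phi n = x
      & forall m n, e m n <-> [/\ S m, S n & E (phi m) (phi n)]].
Proof.
move=> [L [phi [regL phi_surj regEq regE]]].
have [q1 [K1 [K1_gt0 perL]]] := regular_unary_periodic regL.
have [q2 [K2 [K2_gt0 perEq]]] : exists q K, 0 < K /\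
    periodic2 q K (fun m n => [/\ L m, L n & phi m = phi n]).
  apply: regular_conv_periodic; apply: regular_ext regEq => w.
  by split=> [[m [n [? ? ? ?]]]|[m [n [[? ? ?] ?]]]]; exists m, n.
have [q3 [K3 [K3_gt0 perE]]] : exists q K, 0 < K /\
    periodic2 q K (fun m n => [/\ L m, L n & E (phi m) (phi n)]).
  apply: regular_conv_periodic; apply: regular_ext regE => w.
  by split=> [[m [n [? ? ? ?]]]|[m [n [[? ? ?] ?]]]]; exists m, n.
pose K := K1 * K2 * K3; pose q := q1 + q2 + q3.
have K_gt0 : 0 < K by rewrite !muln_gt0 K1_gt0 K2_gt0.
have {}perL : periodic1 q K L.
  have -> : K = (K2 * K3) * K1 by rewrite /K; lia.
  by apply: periodic1_weaken perL _; rewrite /q; lia.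
have {perEq} [eq1 eq2 _] : periodic2 q K (fun m n => [/\ L m, L n & phi m = phi n]).
  have -> : K = (K1 * K3) * K2 by rewrite /K; lia.
  by apply: periodic2_weaken perEq _; rewrite /q; lia.
have {}perE : periodic2 q K (fun m n => [/\ L m, L n & E (phi m) (phi n)]).
  by apply: periodic2_weaken perE _; rewrite /q; lia.
clearbody K q.
pose S n := L n /\ forall m, m < n -> L m -> phi m <> phi n.
have [q' S_per] : exists q', periodic1 q' K S.
  (* With [n] at least [q + q], a smaller code [m] is either beyond [q], and moves along with [n],
     or at least [q] below [n], and stays fixed. *)
  apply: (@antitone_periodic _ (q + q)) => // n Hn [Ln Hmin].
  have {}Ln : L n by apply/perL => //; lia.
  split=> // m mn Lm Emn; case: (leqP q m) => Hm.
    have [LmK _ EK] : [/\ L (m + K), L (n + K) & phi (m + K) = phi (n + K)].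
      by apply/eq1 => //; lia.
    by apply: (Hmin (m + K)) => //; lia.
  have [_ _ EK] : [/\ L m, L (n + K) & phi m = phi (n + K)].
    by apply/eq2 => //; lia.
  by apply: (Hmin m) => //; lia.
pose N := q + q'.
have {}S_per : periodic1 N K S by move=> n Hn; apply: S_per; rewrite /N in Hn; lia.
have [H1 H2 H3] := periodic2_weaken 1 perE (leq_addr q' q : q <= N).
rewrite mul1n in H1 H2 H3.
have eE m n : [/\ S m, S n & E (phi m) (phi n)] <->
    (S m /\ S n) /\ [/\ L m, L n & E (phi m) (phi n)].
  by split=> [[[? ?] [? ?] ?]|[[? ?] []]].
exists S, (fun m n => [/\ S m, S n & E (phi m) (phi n)]), K, N, phi; split=> //.
- split=> //; split=> m n.
  + by move=> Hm Hn; rewrite !eE H1 // !S_per.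
  + by move=> Hn; rewrite !eE H2 // S_per //; lia.
  + by move=> Hn; rewrite !eE H3 // S_per //; lia.
- move=> m n [Lm Hm] [Ln Hn] Emn; case: (ltngtP m n) => // H.
    by case: (Hn m H Lm).
  by case: (Hm n H Ln).
move=> x; have [n [Ln En]] := phi_surj x.
have Hex : exists n, `[< L n /\ phi n = x >] by exists n; apply/asboolP.
case: (ex_minnP Hex) => m /asboolP[Lm Em] Hmin; exists m; split=> //; split=> // k km Lk Ek.
by have := Hmin k; rewrite leqNgt km => /(_ _)/negP[] //; apply/asboolP; split=> //; rewrite Ek.
Qed.

Theorem theorem6p9 (X : Type) (E : X -> X -> Prop) :
  directed_tree E ->
  (unary_FA_presentable E <->
   exists (F : finType) (EF : rel F) (n : nat) (A : 'I_n -> template) (att : 'I_n -> F),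
     [/\ directed_tree (fun a b : F => EF a b),
         (forall i, valid_template (A i))
       & iso_to_attached E EF A att]).
Proof.
move=> E_tree; split.
  move/presentable_periodic => [S [e [K [N [phi [K_gt0 [S_per e_per] inj surj eE]]]]]].
  exact: (periodic_tree_attached K_gt0 S_per e_per E_tree inj surj eE).
move=> [F [EF [n [A [att [[F_inh _ _ _ _] A_valid iso]]]]]].
apply: (attached_presentable _ F_inh iso) => i t.
by have [[_ irr _ _ _] _] := A_valid i; apply/negP/irr.
Qed.
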